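(* Let $BG_{n,m}$ be a bottleneck (two-cluster) graph, that is, an undirected graph consisting of two disjoint cliques $C_1,C_2$ on $n$ and $m$ vertices, respectively, that are connected via a single bridge edge. Equip $BG_{n,m}$ with a weight function that assigns weight $w$ to the bridge and weight $1$ to all other edges. Then its partition function is given by $$Z(q)=q\left(q(q+n)(q+m)+w(q+1)(2q+n+m)\right)(q+n)^{n-2}(q+m)^{m-2}.$$ Further, set $q=q_n>0$ and let $w=w_n$ and $m=m_n$ depend on $n$, where $n\ge m$. Denote by $b,b'$ the two vertices incident to the bridge, by $x,x'$ two vertices that both belong to the clique $C_i$ containing $b$, and by $y$ a vertex in the clique containing $b'$. Then as $n\to\infty$ it holds for the 2-point correlations between these vertices that $$U_q(x,x')\to\begin{cases}0&\text{if }q=o(\sqrt{|C_i|})\\1&\text{if }q=\omega(\sqrt{|C_i|})\end{cases}$$ $$U_q(b,b')\to\begin{cases}0&\text{if }q=o(\tfrac wm)\text{ or }(q=o(w),\ w=\omega(m))\\1&\text{if }q=\omega(w)\text{ or }(q=\omega(\tfrac wm),\ w=o(m))\end{cases}$$ $$U_q(b,x)\to\begin{cases}0&\text{if }q=o(1)\text{ or }(q=o(\sqrt{|C_i|}),\ w=o(m))\text{ or }(q=o(\sqrt{|C_i|}),\ m=o(n))\\ \tfrac{c}{1+c}&\text{if }q=\omega(1),\ q=o(\sqrt{|C_i|}),\ w=\omega(m),\ |C_i|=n,\ m\sim cn\text{ with }c\in(0,1]\\ \tfrac{1}{1+c}&\text{if }q=\omega(1),\ q=o(\sqrt{|C_i|}),\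 w=\omega(m),\ |C_i|=m,\ m\sim cn\text{ with }c\in(0,1]\\1&\text{if }q=\omega(\sqrt{|C_i|})\end{cases}$$ $$U_q(x,y)\to\begin{cases}0&\text{if }q=o(1),\ q=o(\tfrac wm)\\1&\text{if }q=\omega(1)\text{ or }(q=o(1),\ q=\omega(\tfrac wm)).\end{cases}$$
   Context: An undirected weighted graph is considered as a directed graph in which each undirected edge gives two directed edges (one per orientation) of the same weight. A rooted spanning forest of a finite directed graph $G$ is a subset $F$ of its directed edges such that each vertex has at most one outgoing edge in $F$ and $F$ contains no directed cycle; its roots are the vertices without outgoing edge in $F$ and $r(F)$ is the number of roots. The partition function is $Z_G(q)=\sum_Fq^{r(F)}w(F)$ (sum over rooted spanning forests of $G$) with $w(F)=\prod_{e\in F}w(e)$; for $q>0$ the random rooted spanning forest $\Phi_q$ of $G$ has law $\mathbb{P}(\Phi_q=F)=q^{r(F)}w(F)/Z_G(q)$. For distinct vertices $u,v$, the 2-point correlation $U_q(u,v)$ is the probability that $u$ and $v$ belong to different trees (connected components, ignoring orientation) of $\Phi_q$, here for $G=BG_{n,m}$. $|C_i|$ is the number of vertices of the clique $C_i$. Notation: $a_n=\omega(b_n)$ means $b_n=o(a_n)$; $a_n\sim b_n$ means $a_n/b_n\to1$.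
   Formalization: In the third condition for U_q(b,x)→0 (q=o(√|C_i|), m=o(n)) the hypothesis |C_i|=n is added: for b in the smaller clique the claim fails (m~√n, w=n², q=n^{1/8} gives limit 1). The vertices x, x', y are taken not incident to the bridge. *)

(* Defs.v *)
From HB Require Import structures.
From mathcomp Require Import all_boot all_order all_algebra.
From mathcomp Require Import all_classical all_reals all_analysis.
Import Order.TTheory GRing.Theory Num.Theory.
Import numFieldNormedType.Exports.

Set Implicit Arguments.
Unset Strict Implicit.
Unset Printing Implicit Defensive.

Local Open Scope classical_set_scope.
Local Open Scope ring_scope.

(** A finite directed graph on [V] is its set [E] of directed edges; the edge
    [(u, v)] goes from [u] to [v]. *)

Definition directed_by (V : finType) (F : {set V * V}) : rel V :=
  fun u v => (u, v) \in F.

Definition undirected_by (V : finType) (F : {set V * V}) : rel V :=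
  fun u v => ((u, v) \in F) || ((v, u) \in F).

Definition out_edges (V : finType) (F : {set V * V}) (v : V) : {set V * V} :=
  [set e in F | e.1 == v].

(** [ucycle] is the library's notion of simple directed cycle; it includes the
    2-cycles made of both orientations of an undirected edge. *)
Definition rooted_spanning_forest (V : finType) (E F : {set V * V}) : Prop :=
  [/\ F \subset E,
      forall v : V, (#|out_edges F v| <= 1)%N &
      forall c : seq V, c <> [::] -> ~ ucycle (directed_by F) c].

Definition roots (V : finType) (F : {set V * V}) : {set V} :=
  [set v | #|out_edges F v| == 0%N].

Definition forest_weight (R : realType) (V : finType) (wt : V * V -> R)
    (F : {set V * V}) : R :=
  \prod_(e in F) wt e.

Definition partition_function (R : realType) (V : finType) (E : {set V * V})
    (wt : V * V -> R) (q : R) : R :=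
  \sum_(F : {set V * V} | `[< rooted_spanning_forest E F >])
    q ^+ #|roots F| * forest_weight wt F.

(** [P(Phi_q = F)], for [F] a rooted spanning forest. *)
Definition forest_law (R : realType) (V : finType) (E : {set V * V})
    (wt : V * V -> R) (q : R) (F : {set V * V}) : R :=
  q ^+ #|roots F| * forest_weight wt F / partition_function E wt q.

Definition two_point_correlation (R : realType) (V : finType)
    (E : {set V * V}) (wt : V * V -> R) (q : R) (u v : V) : R :=
  \sum_(F : {set V * V} | `[< rooted_spanning_forest E F >] &&
                          ~~ connect (undirected_by F) u v)
    forest_law E wt q F.

(** In [BG_{n,m}] the vertices [inl _] form the clique on [n] vertices and
    [inr _] the clique on [m] vertices; the bridge joins [inl b1] and
    [inr b2].  As [b1] and [b2] are elements of ['I_n] and ['I_m], both cliques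
    are nonempty. *)

Definition bg_adj (n m : nat) (b1 : 'I_n) (b2 : 'I_m) : rel ('I_n + 'I_m) :=
  fun u v => match u, v with
    | inl i, inl j => i != j
    | inr i, inr j => i != j
    | inl i, inr j => (i == b1) && (j == b2)
    | inr j, inl i => (i == b1) && (j == b2)
    end.

Definition bg_edges (n m : nat) (b1 : 'I_n) (b2 : 'I_m) :
    {set ('I_n + 'I_m) * ('I_n + 'I_m)} :=
  [set e | bg_adj b1 b2 e.1 e.2].

(** Among the edges of the graph, only the bridge joins the two sides. *)
Definition bg_weight (R : realType) (n m : nat) (w : R)
    (e : ('I_n + 'I_m) * ('I_n + 'I_m)) : R :=
  match e with
  | (inl _, inr _) | (inr _, inl _) => w
  | _ => 1
  end.

Definition bg_Z (R : realType) (n m : nat) (b1 : 'I_n) (b2 : 'I_m)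
    (w q : R) : R :=
  partition_function (bg_edges b1 b2) (bg_weight w) q.

Definition bg_U (R : realType) (n m : nat) (b1 : 'I_n) (b2 : 'I_m)
    (w q : R) (u v : 'I_n + 'I_m) : R :=
  two_point_correlation (bg_edges b1 b2) (bg_weight w) q u v.

(** The two cliques are indexed by a boolean: [true] is the clique on [n]
    vertices and [false] the one on [m] vertices. *)

Definition bg_clique (n m : nat) (i : bool) : {set 'I_n + 'I_m} :=
  [set v | (if v is inl _ then true else false) == i].

Definition bg_end (n m : nat) (b1 : 'I_n) (b2 : 'I_m) (i : bool) :
    'I_n + 'I_m :=
  if i then inl b1 else inr b2.

(** Vertices that are not incident to the bridge. *)
Definition bg_inner (n m : nat) (b1 : 'I_n) (b2 : 'I_m) (i : bool) :
    {set 'I_n + 'I_m} :=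
  bg_clique n m i :\ bg_end b1 b2 i.

(** The four kinds of pairs of distinct vertices, for [i] the clique of [b];
    [x], [x'] and [y] are not incident to the bridge. *)

Definition pair_kind : Type :=
  forall n m : nat, 'I_n -> 'I_m -> rel ('I_n + 'I_m).

Definition pair_xx' (i : bool) : pair_kind := fun n m b1 b2 u v =>
  [&& u \in bg_inner b1 b2 i, v \in bg_inner b1 b2 i & u != v].

Definition pair_bb' (i : bool) : pair_kind := fun n m b1 b2 u v =>
  (u == bg_end b1 b2 i) && (v == bg_end b1 b2 (~~ i)).

Definition pair_bx (i : bool) : pair_kind := fun n m b1 b2 u v =>
  (u == bg_end b1 b2 i) && (v \in bg_inner b1 b2 i).

Definition pair_xy (i : bool) : pair_kind := fun n m b1 b2 u v =>
  (u \in bg_inner b1 b2 i) && (v \in bg_inner b1 b2 (~~ i)).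

(** [U_q(u, v) -> l] as [n] tends to infinity, for every choice, depending on
    [n], of the bridge and of the pair of the given kind. *)
Definition U_cvg (R : realType) (m : nat -> nat) (w q : nat -> R)
    (kind : pair_kind) (l : R) : Prop :=
  forall eps : R, 0 < eps ->
    \forall n \near \oo,
      forall (b1 : 'I_n) (b2 : 'I_(m n)) (u v : 'I_n + 'I_(m n)),
        kind n (m n) b1 b2 u v ->
        `|bg_U b1 b2 (w n) (q n) u v - l| < eps.

(** [a = omega(b)]. *)
Definition omega (R : realType) (a b : nat -> R) : Prop := b =o_\oo a.

(* Main.v *)
Require Import Defs.
From HB Require Import structures.
From mathcomp Require Import all_boot all_order all_algebra.
From mathcomp Require Import all_classical all_reals all_analysis.
From mathcomp Require Import ring lra zify.
Import Order.TTheory GRing.Theory Num.Theory.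
Import numFieldNormedType.Exports.
Set Implicit Arguments.
Unset Strict Implicit.
Unset Printing Implicit Defensive.
Local Open Scope classical_set_scope.
Local Open Scope ring_scope.

(** Why the theorem holds.

    A forest of the bottleneck graph is cut at the bridge.  What remains is a
    pair of rooted forests of the two cliques.  If the bridge is used from [b]
    to [b'], then [b] is a root of its clique forest, and the factor [q] of
    that root is exchanged for [w]; no other constraint appears, because a path
    that has crossed the bridge cannot come back.  With [C] the total weight of
    the forests of a clique and [D] the weight of those rooted at the end of
    the bridge, stripped of the factor [q] of that root, this gives
      [Z = C1 C2 + w D1 C2 + w C1 D2].
    So the random forest is a mixture of three laws: independent forests of the
    two cliques, the same with [b] conditioned to be a root, the same with [b']
    conditioned to be a root, in proportions [1 : r(n) : r(m)], where
    [r(N) = w D / C = w (q + 1) / (q (q + N))].  Two vertices of one clique are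
    in the same tree exactly if they are so in the forest of that clique; two
    vertices on different sides are in the same tree exactly if the bridge is
    used and each of them is in the tree of its end of the bridge
    ([bg_sum_split], [same_tree_left], [same_tree_across]).

    The complete graph on [s] vertices is treated by exploration: starting from
    a vertex, the parent of the current last vertex of the path is revealed,
    until the path stops at a new root or enters the part [A] already explored.
    If [u] parents are unknown and every vertex of [A] leads to a root in [A],
    the completions weigh [(q + s)^(u-1) (q + |A|)], whatever the shape of the
    explored part ([exit_sum]).  Hence [C = q (q + s)^(s-1)] and
    [D = (q + 1) (q + s)^(s-2)], which is the formula for [Z].  Exploring from
    [x] gives in the same way a recursion for the probability that [x] and [x']
    are in different trees ([apart_sum]): if the path from [x] has [t]
    vertices, then
      [g t = (q + (s - t - 1) g (t + 1)) / (q + s)].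
    The functions [2 q / (t + sqrt s)] and [1 - (t + 1) / q - s / q^2] lie above
    and below its solution, so that the separation probability [g 1] is
    at most of order [q / sqrt s], and tends to 1 if [q / sqrt s] tends to
    infinity.  If the end of the bridge is conditioned to be a root, the same
    bounds hold up to constants for [x] and [x'], whereas the end itself is
    separated from [x] with probability exactly [q / (q + 1)].

    The limits follow by inserting these estimates in the mixture.  The sum
    [r(n) + r(m)] is the odds of the bridge being used, and
    [r(n) / (r(n) + r(m)) = (q + m) / (2 q + n + m)] is the chance that it is
    then used away from the larger clique; it produces the constants
    [c / (1 + c)] and [1 / (1 + c)]. *)

(** * Forests as parent maps *)

Section ParentMaps.
Variable V : finType.
Implicit Types (f g : {ffun V -> option V}) (u v r z : V).

Definition parent f v : V := odflt v (f v).

(** As [parent] fixes the roots, [#|V|] steps are enough to reach the end of any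
    path that ends, so that no choice of a root is needed. *)
Definition tree_root f v : V := iter #|V| (parent f) v.

Definition acyclic f := [forall v, f (tree_root f v) == None].

Lemma parent_root f r : f r = None -> parent f r = r.
Proof. by rewrite /parent => ->. Qed.

Lemma parent_step f v u : f v = Some u -> parent f v = u.
Proof. by rewrite /parent => ->. Qed.

Lemma iter_parent_root f r k : f r = None -> iter k (parent f) r = r.
Proof. by move=> fr; elim: k => //= k ->; exact: parent_root. Qed.

Lemma tree_root_reached f v r :
  fconnect (parent f) v r -> f r = None -> tree_root f v = r.
Proof.
move=> vr fr.
have le_findex : (findex (parent f) v r <= #|V|)%N.
  exact: leq_trans (ltnW (findex_max vr)) (max_card _).
rewrite /tree_root -(subnK le_findex) iterD iter_findex //.
exact: iter_parent_root.
Qed.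

Lemma acyclic_root f v : acyclic f -> f (tree_root f v) = None.
Proof. by move/forallP/(_ v)/eqP. Qed.

Lemma tree_rootE f r : f r = None -> tree_root f r = r.
Proof. exact: iter_parent_root. Qed.

Lemma tree_root_fconnect f u v :
  acyclic f -> fconnect (parent f) u v -> tree_root f u = tree_root f v.
Proof.
move=> acf uv; apply: tree_root_reached; last exact: acyclic_root.
exact: connect_trans uv (fconnect_iter _ _ _).
Qed.

Lemma parent_fconnect f v u : f v = Some u -> fconnect (parent f) v u.
Proof. by move=> fv; apply: connect1; rewrite /= (parent_step fv). Qed.

Lemma tree_root_step f v u :
  acyclic f -> f v = Some u -> tree_root f v = tree_root f u.
Proof. by move=> acf fv; apply: tree_root_fconnect (parent_fconnect fv). Qed.

(** Along a parent step the distance to the root drops; conversely a rank that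
    drops along each step forces every path to end.  Ranks make it easy to glue
    and to restrict acyclic maps. *)
Lemma acyclicP f :
  reflect (exists rank : V -> nat, forall v u, f v = Some u ->
             (rank u < rank v)%N)
          (acyclic f).
Proof.
apply: (iffP idP) => [acf | [rank rank_lt]].
  have ex v : exists k, f (iter k (parent f) v) == None.
    by exists #|V|; exact: (forallP acf v).
  exists (fun v => ex_minn (ex v)) => v u fv.
  case: (ex_minnP (ex v)) => -[|k]; first by rewrite /= fv.
  rewrite iterSr (parent_step fv) => fk _.
  by case: ex_minnP => j _ /(_ k fk).
apply/forallP => v; apply/eqP.
suff [r vr fr] : exists2 r, fconnect (parent f) v r & f r = None.
  by rewrite (tree_root_reached vr fr).
have [N] := ubnP (rank v); elim: N v => // N IH v /ltnSE vN.
case fv: (f v) => [u|]; last by exists v.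
have [|r ur fr] := IH u; first exact: leq_trans (rank_lt _ _ fv) vN.
by exists r => //; apply: connect_trans ur; exact: parent_fconnect.
Qed.

Lemma acyclic_ind f (P : V -> Prop) : acyclic f ->
  (forall v, f v = None -> P v) ->
  (forall v u, f v = Some u -> P u -> P v) -> forall v, P v.
Proof.
move=> /acyclicP[rank rank_lt] P0 PS v.
have [N] := ubnP (rank v); elim: N v => // N IH v /ltnSE vN.
case fv: (f v) => [u|]; last exact: P0.
by apply: PS (fv) _; apply: IH; exact: leq_trans (rank_lt _ _ fv) vN.
Qed.

(** This computes [tree_root] on maps that are glued from pieces: it suffices to
    guess the roots and to check the guess locally. *)
Lemma tree_root_unique f (c : V -> V) v :
  acyclic f -> (forall v, f v = None -> c v = v) ->
  (forall v u, f v = Some u -> c v = c u) -> tree_root f v = c v.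
Proof.
move=> acf c_root c_step; move: v.
apply: (acyclic_ind acf) => [v fv|v u fv IH].
  by rewrite tree_rootE // c_root.
by rewrite (tree_root_step acf fv) IH (c_step _ _ fv).
Qed.

Lemma acyclic_no_loop f v r :
  acyclic f -> fconnect (parent f) v r -> f r = Some v -> False.
Proof.
case/acyclicP => rank rank_lt vr fr.
have : (rank r <= rank v)%N.
  rewrite -(iter_findex vr); elim: (findex _ _ _) => //= k.
  apply: leq_trans; rewrite /parent.
  by case e: (f _) => [u|] //=; apply/ltnW/rank_lt.
by rewrite leqNgt rank_lt.
Qed.

Lemma acyclic_neq f v u :
  acyclic f -> f v = Some u -> v != u.
Proof.
move=> acf fv; apply/eqP => e; rewrite e in fv.
exact: (acyclic_no_loop acf (connect0 _ _) fv).
Qed.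

End ParentMaps.

Section ForestsAsParentMaps.
Variables (R : realType) (V : finType) (E : {set V * V}) (wt : V * V -> R).
Variable q : R.
Implicit Types (f : {ffun V -> option V}) (F : {set V * V}).

Definition arcs f : {set V * V} := [set e | f e.1 == Some e.2].

Definition parent_map F : {ffun V -> option V} :=
  [ffun v => omap snd [pick e in out_edges F v]].

Lemma arcsK : cancel arcs parent_map.
Proof.
move=> f; apply/ffunP => v; rewrite ffunE.
case: pickP => [[v' u]|none] /=.
  by rewrite !inE /= => /andP[/eqP fv /eqP <-].
case fv: (f v) => [u|//].
by have := none (v, u); rewrite !inE /= fv !eqxx.
Qed.

Lemma out_edges_arcs f v :
  out_edges (arcs f) v = if f v is Some u then [set (v, u)]%SET else finset.set0.
Proof.
apply/setP => -[v' u']; rewrite !inE /=.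
case: (eqVneq v' v) => [->|ne]; last first.
  by rewrite andbF; case: (f v) => [u|]; rewrite inE // xpair_eqE (negPf ne).
by rewrite andbT; case: (f v) => [u|]; rewrite !inE ?xpair_eqE ?eqxx /= 1?eq_sym.
Qed.

Lemma parent_mapK F :
  (forall v, (#|out_edges F v| <= 1)%N) -> arcs (parent_map F) = F.
Proof.
move=> out1; apply/setP => -[v u]; rewrite !inE ffunE /=.
case: pickP => [[v' u']|none] /=; last first.
  by have := none (v, u); rewrite !inE /= eqxx andbT => ->.
rewrite inE /= => /andP[F' /eqP ev]; subst v'.
apply/eqP/idP => [[<-]//|Fvu].
have /card_le1_eqP /(_ (v, u) (v, u')) := out1 v.
by rewrite !inE /= eqxx F' Fvu => /(_ isT isT) [->].
Qed.

(** A vertex on a cycle never reaches a root.  Conversely, without cycles the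
    number of vertices that can be reached from [v] drops when [v] moves to its
    parent, so that it is a rank. *)
Lemma acyclic_arcsP f :
  acyclic f <-> (forall c, c <> [::] -> ~ ucycle (directed_by (arcs f)) c).
Proof.
split=> [acf [//|x p] _ /andP[cyc _]|nocyc].
  have : x \in x :: p := mem_head _ _.
  move: {-2}x; apply: (acyclic_ind acf) => [v fv|v u fv IH] vc.
    by have := next_cycle cyc vc; rewrite /directed_by inE /= fv.
  have := next_cycle cyc vc; rewrite /directed_by inE /= fv => /eqP[eu].
  by apply: IH; have -> : u = next (x :: p) v := eu; rewrite mem_next.
pose e := directed_by (arcs f).
apply/acyclicP; exists (fun v => #|connect e v|) => v u fv.
have evu : e v u by rewrite /e /directed_by inE /= fv.
apply: proper_card; apply/properP; split.
  by apply/fintype.subsetP => z; apply: connect_trans (connect1 evu).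
exists v; first exact: connect0.
apply/negP => /connectP[p up ev].
case/shortenP: up ev => p' up' uniq_p _ ev.
apply: (nocyc (u :: p')) => //; apply/andP; split=> //.
by rewrite /= rcons_path up' -ev.
Qed.

Lemma rsf_arcs f :
  `[< rooted_spanning_forest E (arcs f) >] =
  acyclic f && [forall v, if f v is Some u then (v, u) \in E else true].
Proof.
apply/asboolP/andP => [[sub _ /acyclic_arcsP ?]|[/acyclic_arcsP acf all_E]].
  split=> //; apply/forallP => v; case fv: (f v) => [u|//].
  by apply: (fintype.subsetP sub); rewrite inE /= fv.
split=> //.
  apply/fintype.subsetP => -[v u]; rewrite inE /= => /eqP fv.
  by have := forallP all_E v; rewrite fv.
by move=> v; rewrite out_edges_arcs; case: (f v) => *; rewrite ?cards1 ?cards0.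
Qed.

(** The factor that the choice of [v] contributes: the [q] of a root, or the
    weight of the outgoing edge.  Pairs that are not edges get weight 0, which
    allows sums over all acyclic maps. *)
Definition parent_weight (v : V) (o : option V) : R :=
  if o is Some u then (if (v, u) \in E then wt (v, u) else 0) else q.

Lemma forest_weight_arcs f :
  [forall v, if f v is Some u then (v, u) \in E else true] ->
  q ^+ #|Defs.roots (arcs f)| * forest_weight wt (arcs f) =
  \prod_v parent_weight v (f v).
Proof.
move=> all_E.
rewrite (bigID [pred v | f v == None]) /=; congr (_ * _).
  rewrite (eq_bigr (fun=> q)) => [|v /eqP ->//].
  rewrite prodr_const; congr (_ ^+ _); apply: eq_card => v.
  rewrite inE out_edges_arcs unfold_in.
  by case: (f v) => [u|]; rewrite ?cards1 ?cards0.
rewrite /forest_weight (partition_big (fun e => e.1) (fun v => f v != None)).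
  apply: eq_bigr => v fvN; have := forallP all_E v.
  case fv: (f v) fvN => [u|//] _ /= ->.
  rewrite (eq_bigl (pred1 (v, u))) ?big_pred1_eq // => -[v' u'].
  rewrite !inE /= xpair_eqE; case: (eqVneq v' v) => [->|]; last by rewrite andbF.
  by rewrite fv andbT; apply/eqP/eqP => [[->]|->].
by move=> [v u]; rewrite inE /= => /eqP ->.
Qed.

Lemma forest_sumE (phi : {set V * V} -> R) :
  \sum_(F : {set V * V} | `[< rooted_spanning_forest E F >])
     q ^+ #|Defs.roots F| * forest_weight wt F * phi F =
  \sum_(f : {ffun V -> option V} | acyclic f)
     (\prod_v parent_weight v (f v)) * phi (arcs f).
Proof.
rewrite (reindex_onto arcs parent_map) /=; last first.
  by move=> F /asboolP[_ out1 _]; exact: parent_mapK.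
rewrite (eq_bigl (fun f => acyclic f &&
   [forall v, if f v is Some u then (v, u) \in E else true])); last first.
  by move=> f; rewrite arcsK eqxx andbT rsf_arcs.
rewrite big_mkcondr; apply: eq_bigr => f _.
case: ifP => [all_E|/negbT]; first by rewrite forest_weight_arcs.
rewrite negb_forall => /existsP[v].
case fv: (f v) => [u|//] NE.
by rewrite (bigD1 v) //= fv /= (negPf NE) !mul0r.
Qed.

(** The root does not change along an edge, in either direction. *)
Lemma connect_arcs f u v : acyclic f ->
  connect (undirected_by (arcs f)) u v = (tree_root f u == tree_root f v).
Proof.
move=> acf; apply/idP/eqP => [/connectP[p]|].
  elim: p u => [u _ ->//|z p IH u /= /andP[uz pz] ev].
  rewrite -(IH z pz ev); move: uz; rewrite /undirected_by !inE /=.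
  by case/orP => /eqP e; rewrite (tree_root_step acf e).
have up z : connect (undirected_by (arcs f)) z (tree_root f z).
  move: z; apply: (acyclic_ind acf) => [z fz|z z' fz IH].
    by rewrite tree_rootE.
  rewrite (tree_root_step acf fz); apply: connect_trans IH.
  by apply: connect1; rewrite /undirected_by !inE /= fz eqxx.
have sym : connect_sym (undirected_by (arcs f)).
  by apply: sym_connect_sym => x y; rewrite /undirected_by orbC.
by move=> e; apply: connect_trans (up u) _; rewrite e sym.
Qed.

Lemma two_point_correlationE u v :
  two_point_correlation E wt q u v =
  (\sum_(f : {ffun V -> option V} | acyclic f)
     (\prod_z parent_weight z (f z)) * (tree_root f u != tree_root f v)%:R)
  / partition_function E wt q.
Proof.
rewrite /two_point_correlation /forest_law -mulr_suml; congr (_ / _).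
rewrite big_mkcondr /=.
rewrite (eq_bigr (fun F => q ^+ #|Defs.roots F| * forest_weight wt F *
   (~~ connect (undirected_by F) u v)%:R)); last first.
  by move=> F _; case: ifP => _; rewrite ?mulr1 ?mulr0.
rewrite forest_sumE; apply: eq_bigr => f acf.
by rewrite connect_arcs.
Qed.

Lemma partition_functionE :
  partition_function E wt q =
  \sum_(f : {ffun V -> option V} | acyclic f) \prod_z parent_weight z (f z).
Proof.
rewrite /partition_function; under eq_bigr do rewrite -[_ * _]mulr1.
by rewrite forest_sumE; under eq_bigr do rewrite mulr1.
Qed.

End ForestsAsParentMaps.

(** * Exploring a forest of the complete graph *)

Section Exploration.
Local Open Scope set_scope.
Local Open Scope bool_scope.
Variables (R : comNzRingType) (V : finType) (k : R).
Implicit Types (f g : {ffun V -> option V}) (u v r x z : V) (A D T : {set V}).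
Implicit Types (phi : {ffun V -> option V} -> R) (psi : option V -> R).

Let s : R := #|V|%:R.

Definition extends D g f := [forall v in D, f v == g v].

Definition extend g r o : {ffun V -> option V} :=
  [ffun v => if v == r then o else g v].

Definition free_weight D f : R :=
  \prod_(v | v \notin D) (if f v is Some _ then 1 else k).

(** The weight of the acyclic completions of [g], where the vertices of [D]
    have been explored; their own factors are left out. *)
Definition cylinder_sum D g phi : R :=
  \sum_(f | acyclic f && extends D g f) free_weight D f * phi f.

Lemma extendsP D g f : reflect {in D, f =1 g} (extends D g f).
Proof.
apply: (iffP forall_inP) => H v vD; first exact/eqP/H.
by apply/eqP/H.
Qed.

Lemma extends_extend D g r o f : r \notin D ->
  extends (r |: D) (extend g r o) f = (extends D g f && (f r == o)).
Proof.
move=> rD; apply/extendsP/andP => [H | [/extendsP H /eqP fr] v].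
  split; last by rewrite H ?finset.setU11 // ffunE eqxx.
  apply/extendsP => v vD; rewrite H ?finset.setU1r // ffunE.
  by case: eqP => // e; rewrite -e vD in rD.
by rewrite ffunE; case: eqP => [->//|/eqP ne]; rewrite !inE (negPf ne) => /H.
Qed.

Lemma free_weight_setU1 D r f : r \notin D ->
  free_weight D f = (if f r is Some _ then 1 else k) * free_weight (r |: D) f.
Proof.
move=> rD; rewrite /free_weight (bigD1 r) //=; congr (_ * _).
by apply: eq_bigl => v; rewrite !inE negb_or andbC.
Qed.

Lemma big_option (F : option V -> R) :
  \sum_o F o = F None + \sum_v F (Some v).
Proof.
rewrite (bigD1 None) //= (reindex_omap Some id) /=; last by case.
by congr (_ + _); apply: eq_bigl => v; rewrite !eqxx.
Qed.

Lemma cylinder_sum_split D g phi r : r \notin D ->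
  cylinder_sum D g phi =
  k * cylinder_sum (r |: D) (extend g r None) phi +
  \sum_v cylinder_sum (r |: D) (extend g r (Some v)) phi.
Proof.
move=> rD; rewrite /cylinder_sum (partition_big (fun f => f r) predT) //=.
rewrite big_option mulr_sumr; congr (_ + _).
  apply: eq_big => f; first by rewrite extends_extend // andbA.
  by case/andP=> _ /eqP fr; rewrite (free_weight_setU1 _ rD) fr mulrA.
apply: eq_bigr => v _.
apply: eq_big => f; first by rewrite extends_extend // andbA.
by case/andP=> _ /eqP fr; rewrite (free_weight_setU1 _ rD) fr mul1r.
Qed.

Lemma eq_cylinder_sum D g phi c :
  (forall f, acyclic f -> extends D g f -> phi f = c) ->
  cylinder_sum D g phi = c * cylinder_sum D g (fun=> 1).
Proof.
move=> H; rewrite /cylinder_sum mulr_sumr; apply: eq_bigr => f /andP[acf ef].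
by rewrite H // mulr1 mulrC.
Qed.

Lemma cylinder_sum0 D g phi :
  (forall f, acyclic f -> extends D g f -> phi f = 0) ->
  cylinder_sum D g phi = 0.
Proof. by move=> H; rewrite (eq_cylinder_sum H) mul0r. Qed.

Lemma cylinder_sum_cyclic D g phi :
  (forall f, extends D g f -> ~~ acyclic f) -> cylinder_sum D g phi = 0.
Proof.
by move=> H; rewrite cylinder_sum0 // => f acf /H; rewrite acf.
Qed.

Lemma cylinder_sum_full g :
  (forall f, extends [set: V] g f -> acyclic f) ->
  cylinder_sum [set: V] g (fun=> 1) = 1.
Proof.
move=> H; rewrite /cylinder_sum (big_pred1 g) => [|f]; last first.
  rewrite /=; apply/andP/eqP => [[_ /extendsP e]|->].
    by apply/ffunP => v; apply: e; rewrite inE.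
  have e : extends [set: V] g g by apply/extendsP.
  by split; first exact: H.
rewrite mulr1 /free_weight big1 // => v.
by rewrite inE.
Qed.

Definition grounded f v := f (tree_root f v) = None.

Lemma root_grounded f r : f r = None -> grounded f r.
Proof. by move=> fr; rewrite /grounded tree_rootE. Qed.

Lemma fconnect_grounded f v z :
  fconnect (parent f) v z -> grounded f z -> grounded f v.
Proof.
move=> vz gz; rewrite /grounded.
rewrite (tree_root_reached (r := tree_root f z)) //.
exact: connect_trans vz (fconnect_iter _ _ _).
Qed.

Lemma all_grounded f : (forall v, grounded f v) -> acyclic f.
Proof. by move=> H; apply/forallP => v; apply/eqP/H. Qed.

(** An exploration step.  [A] is closed: its vertices lead to roots inside [A].
    [T] is the path or tree under exploration; its vertices lead to the tip
    [r], the only vertex of [A :|: T] whose parent is not known. *)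
Section Step.
Variables (A T : {set V}) (r : V) (g : {ffun V -> option V}).
Hypothesis rT : r \in T.
Hypothesis disAT : [disjoint A & T].

Lemma tip_decided : r |: (A :|: T) :\ r = A :|: T.
Proof. by rewrite finset.setD1K // inE rT orbT. Qed.

Lemma tip_notin : r \notin (A :|: T) :\ r.
Proof. by rewrite !inE eqxx. Qed.

Lemma extends_tip o f : extends (A :|: T) (extend g r o) f ->
  extends ((A :|: T) :\ r) g f /\ f r = o.
Proof.
by rewrite -{1}tip_decided extends_extend ?tip_notin // => /andP[? /eqP].
Qed.

Lemma notin_tree v : v \in T -> v \notin A.
Proof. by move=> vT; rewrite (disjointFl disAT vT). Qed.

(** The tip becomes a root, or is attached to [A], or moves on to a new vertex;
    attaching it to a vertex of [T] would close a cycle. *)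
Lemma cylinder_sum_tip phi :
  (forall f, extends ((A :|: T) :\ r) g f ->
     {in T, forall v, fconnect (parent f) v r}) ->
  cylinder_sum ((A :|: T) :\ r) g phi =
  k * cylinder_sum (A :|: T) (extend g r None) phi +
  \sum_(v in A) cylinder_sum (A :|: T) (extend g r (Some v)) phi +
  \sum_(v in ~: (A :|: T)) cylinder_sum (A :|: T) (extend g r (Some v)) phi.
Proof.
move=> hT; rewrite (cylinder_sum_split _ _ tip_notin) tip_decided -addrA.
congr (_ + _); rewrite (bigID (mem A)) /=; congr (_ + _).
rewrite (bigID (mem T)) /= big1 ?add0r => [|v /andP[_ vT]].
  by apply: eq_bigl => v; rewrite !inE negb_or.
apply: cylinder_sum_cyclic => f /extends_tip[ef fr].
by apply/negP => acf; apply: (acyclic_no_loop acf) fr; exact: hT.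
Qed.

Lemma tip_grounded o :
  (forall f, extends ((A :|: T) :\ r) g f -> {in A, forall v, grounded f v}) ->
  (forall f, extends ((A :|: T) :\ r) g f ->
     {in T, forall v, fconnect (parent f) v r}) ->
  (if o is Some v then v \in A else true) ->
  forall f, extends (A :|: T) (extend g r o) f ->
    {in A :|: T, forall v, grounded f v}.
Proof.
move=> hA hT oA f /extends_tip[ef fr] v; rewrite inE.
case/orP => [|vT]; first exact: hA.
apply: (fconnect_grounded (hT _ ef _ vT)).
case: o oA fr => [z zA fr|_ fr]; last exact: root_grounded.
exact: fconnect_grounded (parent_fconnect fr) (hA _ ef _ zA).
Qed.

Lemma grow_fconnect v :
  (forall f, extends ((A :|: T) :\ r) g f ->
     {in T, forall v, fconnect (parent f) v r}) ->
  forall f, extends (A :|: T) (extend g r (Some v)) f ->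
    {in v |: T, forall u, fconnect (parent f) u v}.
Proof.
move=> hT f /extends_tip[ef fr] u; rewrite !inE => /predU1P[->//|uT].
exact: connect_trans (hT _ ef _ uT) (parent_fconnect fr).
Qed.

Lemma grow_setD1 v : v \notin A :|: T -> (A :|: (v |: T)) :\ v = A :|: T.
Proof.
by move=> vAT; rewrite finset.setUCA finset.setU1K.
Qed.

Lemma grow_disjoint v : v \notin A :|: T -> [disjoint A & v |: T].
Proof.
rewrite inE negb_or => /andP[vA _].
by rewrite -finset.setI_eq0 finset.setIUr finset.setU_eq0 !finset.setI_eq0 disAT
  andbT disjoint_sym finset.disjoints1.
Qed.

Lemma grow_card v n : v \notin A :|: T ->
  #|~: (A :|: T)| = n.+1 -> #|~: (A :|: (v |: T))| = n.
Proof.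
move=> vAT; rewrite (cardsD1 v (~: (A :|: T))) inE vAT => -[<-].
by apply: eq_card => u; rewrite !inE orbCA negb_or.
Qed.

End Step.

(** The function [phi] is assumed to depend only on where the path that starts
    at the tip leaves the complement of [A]: at a new root ([None]) or at a
    vertex of [A].  The shape of the explored part does not matter because of
    the identity
      [(k + a + t) (k + s)^(n-1) + n (k + s)^(n-1) = (k + s)^n],
    where [a + t + n = s]: the first term collects the cases in which the tip
    stops, after which the rest is again an instance of the lemma with closed
    part [A :|: T], and the second one the [n] ways to move on. *)
Lemma exit_sum n g A T r phi psi :
  r \in T -> [disjoint A & T] -> #|~: (A :|: T)| = n ->
  (forall f, extends ((A :|: T) :\ r) g f -> {in A, forall v, grounded f v}) ->
  (forall f, extends ((A :|: T) :\ r) g f ->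
     {in T, forall v, fconnect (parent f) v r}) ->
  (forall f, extends ((A :|: T) :\ r) g f -> acyclic f ->
     forall z, z \notin A -> fconnect (parent f) r z ->
     (if f z is Some v then v \in A else true) -> phi f = psi (f z)) ->
  cylinder_sum ((A :|: T) :\ r) g phi =
  (k + s) ^+ n * (k * psi None + \sum_(v in A) psi (Some v)).
Proof.
elim: n g A T r phi psi => [|n IH] g A T r phi psi rT dis cardn hA hT hphi;
  rewrite cylinder_sum_tip //; set C := (X in k * X + _ + _ = _);
  have stop o : (if o is Some v then v \in A else true) ->
    cylinder_sum (A :|: T) (extend g r o) phi =
    psi o * cylinder_sum (A :|: T) (extend g r o) (fun=> 1).
- move=> oA; apply: eq_cylinder_sum => f acf /extends_tip[//|ef fr].
  rewrite -fr; apply: (hphi f) => //; first exact: (notin_tree dis).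
  by rewrite fr.
- have AT : A :|: T = [set: V] 
    by rewrite -[LHS]finset.setCK (cards0_eq cardn) finset.setC0.
  have closed o : (if o is Some v then v \in A else true) ->
      cylinder_sum (A :|: T) (extend g r o) (fun=> 1) = 1.
    move=> oA; rewrite AT cylinder_sum_full // => f ef.
    apply: all_grounded => v.
    by apply: (tip_grounded rT hA hT oA); rewrite ?AT ?inE.
  rewrite expr0 mul1r [X in _ + X]big1 ?addr0; last first.
    by move=> v; rewrite AT !inE.
  rewrite /C stop // closed // mulr1; congr (_ + _).
  by apply: eq_bigr => v vA; rewrite stop // closed // mulr1.
- move=> oA; apply: eq_cylinder_sum => f acf /extends_tip[//|ef fr].
  rewrite -fr; apply: (hphi f) => //; first exact: (notin_tree dis).
  by rewrite fr.
have closed o : (if o is Some v then v \in A else true) ->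
    cylinder_sum (A :|: T) (extend g r o) (fun=> 1) =
    (k + s) ^+ n * (k + #|A :|: T|%:R).
  move=> oA; have /card_gt0P[v] : (0 < #|~: (A :|: T)|)%N by rewrite cardn.
  rewrite inE => vAT.
  have D1 : ((A :|: T) :|: [set v]) :\ v = A :|: T.
    by rewrite finset.setUC finset.setU1K.
  have gr := tip_grounded rT hA hT oA.
  rewrite -{1}D1 (IH _ (A :|: T) [set v] v _ (fun=> 1)) ?D1 //.
  - by rewrite sumr_const mulr1.
  - by rewrite finset.set11.
  - by rewrite disjoint_sym finset.disjoints1.
  - by rewrite finset.setUC -(grow_card (T := T) vAT cardn) finset.setUCA.
  - by move=> f _ u; rewrite inE => /eqP ->.
have grow v : v \in ~: (A :|: T) ->
    cylinder_sum (A :|: T) (extend g r (Some v)) phi =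
    (k + s) ^+ n * (k * psi None + \sum_(u in A) psi (Some u)).
  rewrite inE => vAT; rewrite -{1}(grow_setD1 vAT).
  apply: IH; rewrite ?grow_setD1 //.
  - by rewrite finset.setU11.
  - exact: grow_disjoint.
  - exact: grow_card.
  - by move=> f /extends_tip[//|ef _]; exact: hA.
  - exact: grow_fconnect.
  move=> f /extends_tip[//|ef fr] acf z zA vz; apply: hphi => //.
  exact: connect_trans (parent_fconnect fr) vz.
rewrite /C stop // closed //.
rewrite (eq_bigr _ (fun v vA => stop (Some v) vA)).
rewrite (eq_bigr _ (fun v vA =>
  congr1 ( *%R (psi (Some v))) (closed (Some v) vA))).
rewrite (eq_bigr _ grow) sumr_const cardn -mulr_suml -mulr_natl.
have -> : s = #|A :|: T|%:R + n.+1%:R :> R.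
  by rewrite /s -(cardsC (A :|: T)) cardn natrD.
by rewrite exprS; ring.
Qed.

(** Here [A] is empty or a single root.  The tree of [x] grows along the path
    from [x].  If the path stops at a new root, [x'] is apart from [x] when its
    own path stops at another new root or in [A]; if it stops in [A], only the
    first possibility remains; if it meets [x'], both are in the same tree.
    By [exit_sum] the stopping cases contribute the constant term of the
    recursion, and the [n] other vertices the term with [H n.-1]. *)
Lemma apart_sum x x' n H g A T r :
  x \in T -> x' \notin A :|: T ->
  r \in T -> [disjoint A & T] -> #|~: (A :|: T)| = n.+1 ->
  (#|A| <= 1)%N -> {in A, g =1 fun=> None} ->
  (forall f, extends ((A :|: T) :\ r) g f ->
     {in T, forall v, fconnect (parent f) v r}) ->
  (forall j, (k + s) * H j = k * (k + #|A|%:R *+ 2) + j%:R * H j.-1) ->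
  cylinder_sum ((A :|: T) :\ r) g
    (fun f => (tree_root f x != tree_root f x')%:R) =
  (k + s) ^+ n.+1 * H n.
Proof.
move=> + + + + + cardA + + Hrec.
elim/ltn_ind: n g T r => n IH g T r xT x'AT rT dis cardn gA hT.
have rA : r \notin A := notin_tree dis rT.
have rootA f : extends ((A :|: T) :\ r) g f -> {in A, forall v, f v = None}.
  move=> /extendsP ef v vA; rewrite ef ?gA // !inE vA andbT.
  by apply: contraNneq rA => <-.
have hA f : extends ((A :|: T) :\ r) g f -> {in A, forall v, grounded f v}.
  by move=> ef v vA; apply/root_grounded/(rootA f).
have D1 : ((A :|: T) :|: [set x']) :\ x' = A :|: T.
  by rewrite finset.setUC finset.setU1K.
have cardn' : #|~: ((A :|: T) :|: [set x'])| = n.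
  by rewrite finset.setUC -(grow_card (T := T) x'AT cardn) finset.setUCA.
have stop o psi : (if o is Some v then v \in A else true) ->
    (forall f, extends (A :|: T) (extend g r o) f -> acyclic f ->
       forall z, z \notin A :|: T -> fconnect (parent f) x' z ->
       (if f z is Some v then v \in A :|: T else true) ->
       (tree_root f x != tree_root f x')%:R = psi (f z)) ->
    cylinder_sum (A :|: T) (extend g r o)
      (fun f => (tree_root f x != tree_root f x')%:R) =
    (k + s) ^+ n * (k * psi None + \sum_(v in A :|: T) psi (Some v)).
  move=> oA hpsi; rewrite -{1}D1 (exit_sum (n := n) (psi := psi)) ?D1 //.
  - by rewrite finset.set11.
  - by rewrite disjoint_sym finset.disjoints1.
  - exact: tip_grounded.
  - by move=> f _ u; rewrite inE => /eqP ->.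
have xr f : extends ((A :|: T) :\ r) g f -> acyclic f ->
    {in T, forall v, tree_root f v = tree_root f r}.
  by move=> ef acf v vT; apply: tree_root_fconnect (hT _ ef _ vT).
rewrite cylinder_sum_tip //.
rewrite (stop None (fun o => if o is Some v then (v \in A)%:R else 1)) //;
  last first.
  move=> f /extends_tip[//|ef fr] acf z zAT x'z.
  rewrite (xr _ ef acf _ xT) (tree_rootE fr).
  rewrite (tree_root_fconnect acf x'z).
  case fz: (f z) => [v|] => [vAT|_]; last first.
    rewrite tree_rootE //; case: eqP zAT => // <-.
    by rewrite inE rT orbT.
  rewrite (tree_root_step acf fz).
  have [vA|vNA] := boolP (v \in A).
    rewrite tree_rootE ?(rootA _ ef) //.
    by case: eqP rA => // ->; rewrite vA.
  have vT : v \in T by move: vAT; rewrite inE (negPf vNA).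
  by rewrite (xr _ ef acf _ vT) (tree_rootE fr) eqxx.
have stopA v : v \in A -> cylinder_sum (A :|: T) (extend g r (Some v))
      (fun f => (tree_root f x != tree_root f x')%:R) = (k + s) ^+ n * k.
  move=> vA; rewrite (stop _ (fun o => if o is Some v then 0 else 1)) //.
    by rewrite big1 // addr0 mulr1.
  move=> f /extends_tip[//|ef fr] acf z zAT x'z.
  rewrite (xr _ ef acf _ xT) (tree_root_step acf fr).
  rewrite (tree_rootE (rootA _ ef _ vA)).
  rewrite (tree_root_fconnect acf x'z).
  case fz: (f z) => [u|] => [uAT|_]; last first.
    rewrite tree_rootE //; case: eqP zAT => // <-.
    by rewrite inE vA.
  rewrite (tree_root_step acf fz).
  have [uA|uNA] := boolP (u \in A).
    have /card_le1_eqP/(_ _ _ uA vA) e := cardA.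
    by rewrite -e (tree_rootE (rootA _ ef _ vA)) eqxx.
  have uT : u \in T by move: uAT; rewrite inE (negPf uNA).
  by rewrite (xr _ ef acf _ uT) (tree_root_step acf fr)
    (tree_rootE (rootA _ ef _ vA)) eqxx.
rewrite (eq_bigr _ stopA) sumr_const.
have x'C : x' \in ~: (A :|: T) by rewrite inE.
rewrite [X in _ + X](bigD1 x') //= cylinder_sum0 ?add0r; last first.
  move=> f acf /extends_tip[//|ef fr].
  by rewrite (xr _ ef acf _ xT) (tree_root_step acf fr) eqxx.
rewrite [X in _ + X](eq_bigr (fun=> (k + s) ^+ n * H n.-1)); last first.
  move=> v /andP[]; rewrite inE => vAT vx'.
  have n0 : (n = n.-1.+1)%N.
    rewrite prednK // -ltnS -cardn (cardsD1 x') x'C ltnS card_gt0.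
    by apply/set0Pn; exists v; rewrite !inE vx' -finset.in_setU.
  have cardv := grow_card vAT cardn.
  rewrite -{1}(grow_setD1 vAT) [in (k + s) ^+ n]n0.
  apply: IH; rewrite ?grow_setD1 //.
  - by rewrite n0.
  - by rewrite inE xT orbT.
  - by move: x'AT; rewrite !inE [x' == v]eq_sym (negPf vx').
  - by rewrite finset.setU11.
  - exact: grow_disjoint.
  - by rewrite cardv.
  - by move=> u uA; rewrite ffunE gA //; case: eqP uA => // ->; rewrite (negPf rA).
  - exact: grow_fconnect.
have -> : \sum_(v in A :|: T) (v \in A)%:R = #|A|%:R :> R.
  rewrite -[#|A|]sum1_card natr_sum big_mkcond [RHS]big_mkcond.
  by apply: eq_bigr => v _; rewrite inE; case: (v \in A) => //; case: ifP.
rewrite sumr_const.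
have -> : #|[pred v in ~: (A :|: T) | v != x']| = n.
  rewrite -cardn'; apply: eq_card => v.
  by rewrite !inE; do 2!case: (v \in _) => //=.
rewrite [(k + s) ^+ n.+1]exprS [_ * _ ^+ n]mulrC -mulrA Hrec; ring.
Qed.
End Exploration.

(** * Weights of forests of the complete graph *)

Section CompleteGraph.
Local Open Scope set_scope.
Local Open Scope bool_scope.
Variables (R : comNzRingType) (V : finType) (k : R).
Implicit Types (f : {ffun V -> option V}) (b x : V).
Implicit Types (phi : {ffun V -> option V} -> R).

Let s : R := #|V|%:R.

Definition clique_sum phi : R :=
  \sum_(f | acyclic f) free_weight k finset.set0 f * phi f.

(** The factor [k] of the root [b] is left out. *)
Definition rooted_sum b phi : R :=
  \sum_(f | acyclic f && (f b == None)) free_weight k [set b]%SET f * phi f.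

Let g0 : {ffun V -> option V} := [ffun=> None].

Lemma clique_sumE x phi :
  clique_sum phi = cylinder_sum k ((finset.set0 :|: [set x]%SET) :\ x) g0 phi.
Proof.
rewrite finset.set0U finset.setDv; apply: eq_bigl => f.
by rewrite (introT (extendsP _ _ _)) ?andbT // => v; rewrite inE.
Qed.

Lemma rooted_sumE b x phi : x != b ->
  rooted_sum b phi = cylinder_sum k (([set b]%SET :|: [set x]%SET) :\ x) g0 phi.
Proof.
move=> xb; rewrite finset.setUC finset.setU1K ?inE //.
apply: eq_bigl => f; congr (_ && _); apply/eqP/extendsP => [fb v|-> //].
  by rewrite inE => /eqP ->; rewrite ffunE.
  by rewrite ffunE.
by rewrite inE.
Qed.

Lemma extends_set1_connect (g : {ffun V -> option V}) D x f :
  extends D g f -> {in [set x]%SET, forall v, fconnect (parent f) v x}.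
Proof. by move=> _ v; rewrite inE => /eqP ->. Qed.

Lemma card_setC_pair b x : x != b ->
  #|~: ([set b]%SET :|: [set x]%SET)| = #|V|.-2.
Proof.
by move=> xb; rewrite cardsCs finset.setCK cards2 eq_sym xb subn2.
Qed.

Lemma clique_sum1 n : #|V| = n.+1 -> clique_sum (fun=> 1) = k * (k + s) ^+ n.
Proof.
move=> cardV; have /card_gt0P[x _] : (0 < #|V|)%N by rewrite cardV.
rewrite (clique_sumE x) (exit_sum _ (n := n) (psi := fun=> 1)) //.
- by rewrite big_set0 addr0 mulr1 mulrC.
- by rewrite finset.set11.
- by rewrite -finset.setI_eq0 finset.set0I.
- by rewrite finset.set0U cardsC1 cardV.
- by move=> f _ v; rewrite inE.
- by move=> f; exact: extends_set1_connect.
Qed.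

Lemma exists_neq b : (1 < #|V|)%N -> exists x, x != b.
Proof.
move=> V1; have /card_gt0P[x] : (0 < #|[set~ b]%SET|)%N.
  by rewrite cardsC1 -ltnS prednK // ltnW.
by rewrite !inE => xb; exists x.
Qed.

Lemma rooted_g0 (D : {set V}) b f : b \in D -> extends D g0 f -> f b = None.
Proof. by move=> bD /extendsP ->; rewrite ?ffunE. Qed.

Lemma rooted_grounded b x f : x != b ->
  extends (([set b]%SET :|: [set x]%SET) :\ x) g0 f ->
  {in [set b]%SET, forall v, grounded f v}.
Proof.
move=> xb ef v; rewrite inE => /eqP ->; apply: root_grounded.
by apply: rooted_g0 ef; rewrite !inE eqxx eq_sym xb.
Qed.

Lemma rooted_sum1 b n : #|V| = n.+2 ->
  rooted_sum b (fun=> 1) = (k + s) ^+ n * (k + 1).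
Proof.
move=> cardV; have [|x xb] := exists_neq b; first by rewrite cardV.
rewrite (rooted_sumE _ xb) (exit_sum _ (n := n) (psi := fun=> 1)) //.
- by rewrite big_set1 mulr1.
- by rewrite finset.set11.
- by rewrite finset.disjoints1 inE eq_sym.
- by rewrite card_setC_pair // cardV.
- by move=> f; exact: rooted_grounded.
- by move=> f; exact: extends_set1_connect.
Qed.

Lemma rooted_sum1_trivial b : #|V| = 1%N -> rooted_sum b (fun=> 1) = 1.
Proof.
move=> cardV; have bT : [set b]%SET = [set: V]%SET.
  by apply/eqP; rewrite eqEcard finset.subsetT cards1 cardsT cardV.
have only v : v = b by have := finset.in_setT v; rewrite -bT inE => /eqP.
rewrite /rooted_sum (big_pred1 g0) => [|f]; last first.
  rewrite /=; apply/andP/eqP => [[_ /eqP fb]|->].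
    by apply/ffunP => v; rewrite ffunE (only v).
  split; last by rewrite ffunE.
  by apply/forallP => v; rewrite ffunE.
by rewrite mulr1 /free_weight bT big1 // => v; rewrite inE.
Qed.

(** The path from [x] stops at [b] with weight 1, or at a new root with weight
    [k]; only the latter separates [x] from [b]. *)
Lemma rooted_sum_apart b x n : x != b -> #|V| = n.+2 ->
  rooted_sum b (fun f => (tree_root f b != tree_root f x)%:R) =
  (k + s) ^+ n * k.
Proof.
move=> xb cardV.
rewrite (rooted_sumE _ xb)
  (exit_sum _ (n := n) (psi := fun o => if o is Some v then 0 else 1)) //.
- by rewrite big1 ?addr0 ?mulr1.
- by rewrite finset.set11.
- by rewrite finset.disjoints1 inE eq_sym.
- by rewrite card_setC_pair // cardV.
- by move=> f; exact: rooted_grounded.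
- by move=> f; exact: extends_set1_connect.
move=> f ef acf z zb xz.
have fb : f b = None by apply: rooted_g0 ef; rewrite !inE eqxx eq_sym xb.
rewrite (tree_root_fconnect acf xz) tree_rootE //.
case fz: (f z) => [v|] => [|_].
  by rewrite inE (tree_root_step acf fz) => /eqP ->; rewrite tree_rootE ?eqxx.
by rewrite tree_rootE // eq_sym; move: zb; rewrite inE => ->.
Qed.

Lemma clique_sum_apart x x' n H : x != x' -> #|V| = n.+2 ->
  (forall j, (k + s) * H j = k * k + j%:R * H j.-1) ->
  clique_sum (fun f => (tree_root f x != tree_root f x')%:R) =
  (k + s) ^+ n.+1 * H n.
Proof.
move=> xx' cardV Hrec; rewrite (clique_sumE x) (apart_sum _ (n := n) (H := H)) //.
- by rewrite finset.set11.
- by rewrite !inE eq_sym.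
- by rewrite finset.set11.
- by rewrite -finset.setI_eq0 finset.set0I.
- by rewrite finset.set0U cardsC1 cardV.
- by rewrite cards0.
- by move=> v; rewrite inE.
- by move=> f; exact: extends_set1_connect.
- by move=> j; rewrite cards0 mul0rn addr0.
Qed.

Lemma rooted_sum_apart2 b x x' n H :
  x != b -> x' != b -> x != x' -> #|V| = n.+3 ->
  (forall j, (k + s) * H j = k * (k + 2) + j%:R * H j.-1) ->
  rooted_sum b (fun f => (tree_root f x != tree_root f x')%:R) =
  (k + s) ^+ n.+1 * H n.
Proof.
move=> xb x'b xx' cardV Hrec; rewrite (rooted_sumE _ xb).
rewrite (apart_sum _ (n := n) (H := H)) //.
- by rewrite finset.set11.
- by rewrite !inE negb_or x'b eq_sym.
- by rewrite finset.set11.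
- by rewrite finset.disjoints1 inE eq_sym.
- by rewrite card_setC_pair // cardV.
- by rewrite cards1.
- by move=> v _; rewrite ffunE.
- by move=> f; exact: extends_set1_connect.
- by move=> j; rewrite cards1.
Qed.

End CompleteGraph.

(** * Bounds on the apart_sum probability in the complete graph *)

Section SeparationRecursion.
Variables (R : realType) (k s src : R).

(** The solution of the recursion of [apart_sum], divided by the weight of all
    completions: a conditional probability of separation when [j] vertices
    other than [x'] are unexplored. *)
Fixpoint apart_prob (j : nat) : R :=
  (src + (if j is j'.+1 then j%:R * apart_prob j' else 0)) / (k + s).

Lemma apart_probE j : 0 < k -> 1 <= s ->
  (k + s) * apart_prob j = src + j%:R * apart_prob j.-1.
Proof.
move=> k0 s1; have ks0 : 0 < k + s by lra.
by case: j => [|j] /=; rewrite mulrCA divff ?gt_eqF // mulr1 // mul0r.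
Qed.

Lemma apart_prob_ge0 j : 0 < k -> 1 <= s -> k <= src -> 0 <= apart_prob j.
Proof.
move=> k0 s1 src_ge; have ks0 : 0 < k + s by lra.
elim: j => [|j IH]; rewrite -(pmulr_rge0 _ ks0) apart_probE //; first by lra.
by apply: addr_ge0; [lra | exact: mulr_ge0].
Qed.

Lemma apart_prob_le1 j : 0 < k -> 1 <= s -> src + j%:R <= k + s ->
  apart_prob j <= 1.
Proof.
move=> k0 s1; have ks0 : 0 < k + s by lra.
elim: j => [|j IH] src_le; rewrite -(ler_pM2l ks0) apart_probE // mulr1.
  by lra.
have {}IH : apart_prob j <= 1 by apply: IH; move: src_le; rewrite -natr1; lra.
have : j.+1%:R * apart_prob j <= j.+1%:R * 1 by rewrite ler_pM2l.
by rewrite [_.-1]/= mulr1; lra.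
Qed.

(** The function [2 c k / (t + r)] of the size [t] of the explored part is a
    supersolution of the recursion, [r] being the square root of [s].  Beyond
    [sqrt s] it decays like [k / t], the order of the chance to meet a root
    before one of [t] given vertices; before [sqrt s] it stays of order
    [k / sqrt s], because the tree grows to that size with few stops. *)
Lemma apart_prob_le c r j t :
  0 < k -> 1 <= s -> k <= src -> src <= c * k -> r ^+ 2 = s -> 1 <= r ->
  j%:R + t%:R + 1 <= s -> apart_prob j * (t%:R + r) <= 2 * c * k.
Proof.
move=> k0 s1 src_ge src_le rs r1; have ks0 : 0 < k + s by lra.
elim: j t => [|j IH] t jt; rewrite -(ler_pM2l ks0).
  rewrite mulrA apart_probE // mul0r addr0.
  have t0 : 0 <= t%:R :> R by [].
  have : src * (t%:R + r) <= c * k * (t%:R + r) by rewrite ler_pM2r //; lra.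
  have : c * k * (t%:R + r) <= c * k * (2 * s + 2 * k).
    rewrite ler_wpM2l //; first by lra.
    by rewrite add0r in jt; nra.
  by lra.
have t0 : 0 <= t%:R :> R by [].
have j0 : 0 <= j%:R :> R by [].
rewrite -natr1 in jt.
have {}IH : apart_prob j * (t%:R + 1 + r) <= 2 * c * k.
  by rewrite natr1; apply: IH; rewrite -natr1; lra.
set y := t%:R + 1 + r in IH.
have y0 : 0 < y by rewrite /y; lra.
have a0 := apart_prob_ge0 j k0 s1 src_ge.
rewrite mulrA apart_probE //= -natr1 -(ler_pM2r y0).
have ck : 0 <= c * k by lra.
have h1 : src * (t%:R + r) * y <= c * k * ((t%:R + r) * y).
  by rewrite -mulrA; apply: ler_wpM2r => //; apply: mulr_ge0; lra.
have h2 : (j%:R + 1) * (t%:R + r) * (apart_prob j * y) <=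
          (j%:R + 1) * (t%:R + r) * (2 * c * k).
  by apply: ler_wpM2l => //; apply: mulr_ge0; lra.
have h3 : c * k * ((t%:R + r) * y + 2 * (j%:R + 1) * (t%:R + r)) <=
          c * k * (2 * (k + s) * y).
  apply: ler_wpM2l => //.
  have h4 : (j%:R + 1) * (t%:R + r) <= (s - t%:R - 1) * (t%:R + r).
    by apply: ler_wpM2r; lra.
  have h5 : 0 <= k * y by apply: mulr_ge0; lra.
  by rewrite /y in h5 *; nra.
by nra.
Qed.

(** With [t] for [s - j], the function [t / k + s / k ^ 2] solves the recursion
    for the complementary probability when the number of unexplored vertices is
    overestimated by [s]. *)
Lemma apart_prob_ge j : 0 < k -> 1 <= s -> k <= src -> j%:R <= s ->
  1 - apart_prob j <= (s - j%:R) / k + s / k ^+ 2.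
Proof.
move=> k0 s1 src_ge; have ks0 : 0 < k + s by lra.
elim: j => [|j IH] js; rewrite -(ler_pM2l ks0) mulrBr mulr1 apart_probE //.
  have -> : (k + s) * ((s - 0) / k + s / k ^+ 2) =
    s + s / k + s * (s / k) + s * (s / k ^+ 2) by field; rewrite gt_eqF.
  have h : 0 <= s / k by apply: divr_ge0; lra.
  have : 0 <= s / k ^+ 2 by apply: divr_ge0; [lra | exact: sqr_ge0].
  by move=> h'; have : 0 <= s * (s / k) by [apply: mulr_ge0; lra];
     have : 0 <= s * (s / k ^+ 2) by [apply: mulr_ge0; lra]; lra.
rewrite -natr1 in js *; rewrite [_.-1]/=.
have {}IH : 1 - apart_prob j <= (s - j%:R) / k + s / k ^+ 2 by apply: IH; lra.
have j0 : 0 <= j%:R :> R by [].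
set d := 1 - apart_prob j in IH; have -> : apart_prob j = 1 - d by rewrite /d; ring.
have -> : (k + s) * ((s - (j%:R + 1)) / k + s / k ^+ 2) =
  s - (j%:R + 1) + s * ((s - j%:R) / k + s / k ^+ 2).
  by field; rewrite gt_eqF.
set e := _ / k + _ in IH *.
have e0 : 0 <= e.
  by apply: addr_ge0; apply: divr_ge0; rewrite ?sqr_ge0 //; lra.
have h1 : (j%:R + 1) * d <= (j%:R + 1) * e by apply: ler_wpM2l => //; lra.
have h2 : (j%:R + 1) * e <= s * e by apply: ler_wpM2r.
by nra.
Qed.

End SeparationRecursion.

(** What the limits use of a separation probability [a] in a clique on [N]
    vertices; the constants cover both the free forest and the one that is
    conditioned on its root. *)
Definition apart_bounds (R : realType) (q N a : R) : Prop :=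
  [/\ 0 <= a, a <= 1, a * Num.sqrt N <= 4 * q & 1 - a <= 3 / q + N / q ^+ 2].

Section CompleteGraphBounds.
Variables (R : realType) (V : finType) (q : R).
Let s : R := #|V|%:R.

Lemma sqrt_facts : 1 <= s -> Num.sqrt s ^+ 2 = s /\ 1 <= Num.sqrt s.
Proof.
move=> s1; rewrite sqr_sqrtr; last by lra.
by split=> //; rewrite -sqrtr1 ler_wsqrtr.
Qed.

Lemma clique_apart x x' : 0 < q -> x != x' -> exists2 a, apart_bounds q s a &
  clique_sum q (fun f : {ffun V -> option V} =>
    (tree_root f x != tree_root f x')%:R) = clique_sum (V := V) q (fun=> 1) * a.
Proof.
move=> q0 xx'.
have [n cardV] : exists n, #|V| = n.+2.
  exists #|V|.-2; rewrite -subn2 -addn2 subnK //.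
  by apply/card_gt1P; exists x, x'.
have sE : s = n%:R + 2 by rewrite /s cardV -addn2 natrD.
have n0 : 0 <= n%:R :> R by [].
have s1 : 1 <= s by lra.
have [rs r1] := sqrt_facts s1.
exists (apart_prob q s q n); last first.
  rewrite (clique_sum_apart (H := fun j => q * apart_prob q s q j) xx' cardV).
    by rewrite (clique_sum1 _ cardV) -/s; ring.
  by move=> j; rewrite mulrCA -/s apart_probE //; ring.
split; first exact: apart_prob_ge0.
- by apply: apart_prob_le1 => //; lra.
- have := @apart_prob_le _ q s q 1 (Num.sqrt s) n 0 q0 s1 (lexx _) _ rs r1 _.
  rewrite add0r mul1r => /(_ (lexx _)) H; apply: le_trans (H _) _; last by lra.
  by rewrite addr0; lra.
apply: le_trans (apart_prob_ge q0 s1 (lexx _) _) _; first by lra.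
by rewrite sE lerD2r ler_pM2r ?invr_gt0 //; lra.
Qed.

(** The root [b] offers one more way to separate, of weight [q / (q + 1)], at
    most doubling the constant term of the recursion. *)
Lemma rooted_apart2 b x x' : 0 < q -> x != b -> x' != b -> x != x' ->
  exists2 a, apart_bounds q s a &
  rooted_sum q b (fun f : {ffun V -> option V} =>
    (tree_root f x != tree_root f x')%:R) = rooted_sum q b (fun=> 1) * a.
Proof.
move=> q0 xb x'b xx'.
have [n cardV] : exists n, #|V| = n.+3.
  exists #|V|.-2.-1; rewrite -subn2 -subn1 -subnDA -addn3 subnK //.
  by apply/card_gt2P; exists x, x', b; split=> //; rewrite ?xx' ?x'b // eq_sym.
have sE : s = n%:R + 3 by rewrite /s cardV -addn3 natrD.
have n0 : 0 <= n%:R :> R by [].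
have s1 : 1 <= s by lra.
have [rs r1] := sqrt_facts s1.
pose src := q * (q + 2) / (q + 1).
have srcE : src = q + q / (q + 1) by rewrite /src; field; lra.
have frac0 : 0 <= q / (q + 1) by apply: divr_ge0; lra.
have frac1 : q / (q + 1) <= 1 by rewrite ler_pdivrMr; lra.
have fracq : q / (q + 1) <= q by rewrite ler_pdivrMr; [nra | lra].
have src_ge : q <= src by lra.
exists (apart_prob q s src n); last first.
  rewrite (rooted_sum_apart2 (H := fun j => (q + 1) * apart_prob q s src j)
    xb x'b xx' cardV).
    by rewrite (rooted_sum1 _ _ cardV) -/s exprS; ring.
  move=> j; rewrite mulrCA -/s apart_probE // mulrDr.
  congr (_ + _); last by rewrite mulrCA.
  by rewrite /src; field; lra.
split; first exact: apart_prob_ge0.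
- by apply: apart_prob_le1 => //; lra.
- have := @apart_prob_le _ q s src 2 (Num.sqrt s) n 0 q0 s1 src_ge _ rs r1 _.
  rewrite add0r addr0 => H; apply: le_trans (H _ _) _; lra.
apply: le_trans (apart_prob_ge q0 s1 src_ge _) _; first by lra.
by rewrite sE lerD2r ler_pM2r ?invr_gt0 //; lra.
Qed.

Lemma rooted_apart b x : 0 < q -> x != b ->
  rooted_sum q b (fun f : {ffun V -> option V} =>
    (tree_root f b != tree_root f x)%:R) =
  rooted_sum q b (fun=> 1) * (q / (q + 1)).
Proof.
move=> q0 xb.
have [n cardV] : exists n, #|V| = n.+2.
  exists #|V|.-2; rewrite -subn2 -addn2 subnK //.
  by apply/card_gt1P; exists x, b.
rewrite (rooted_sum_apart _ xb cardV) (rooted_sum1 _ _ cardV).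
by field; lra.
Qed.

End CompleteGraphBounds.

Section IntegerPowers.
Variables (R : realType) (V : finType) (q : R).
Let s : R := #|V|%:R.
Hypothesis ok : (1 < #|V|)%N \/ q + s != 0.

(** The integer exponent lets this cover the clique with one vertex, where the
    value is [q]. *)
Lemma clique_sumZ (b : V) : clique_sum q (fun f : {ffun V -> option V} => 1) =
  q * (q + s) * (q + s) ^ (#|V|%:Z - 2).
Proof.
case cardV: #|V| ok => [|[|n]] qs.
- by have := card0_eq cardV b; rewrite inE.
- have {}qs : q + s != 0 by case: qs.
  rewrite (clique_sum1 _ cardV) expr0 mulr1.
  have -> : (1%:Z - 2 = -1)%R by [].
  by rewrite exprN1 mulfK.
rewrite (clique_sum1 _ cardV).
have -> : (n.+2%:Z - 2 = n%:Z)%R by lia.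
by rewrite -/s exprS mulrA.
Qed.

Lemma rooted_sumZ (b : V) : rooted_sum q b (fun f : {ffun V -> option V} => 1) =
  (q + 1) * (q + s) ^ (#|V|%:Z - 2).
Proof.
case cardV: #|V| ok => [|[|n]] qs.
- by have := card0_eq cardV b; rewrite inE.
- have {}qs : q + s != 0 by case: qs.
  rewrite (rooted_sum1_trivial _ _ cardV).
  have -> : (1%:Z - 2 = -1)%R by [].
  by rewrite exprN1; move: qs; rewrite /s cardV => qs; rewrite divff.
rewrite (rooted_sum1 _ _ cardV).
have -> : (n.+2%:Z - 2 = n%:Z)%R by lia.
by rewrite mulrC.
Qed.
End IntegerPowers.

(** * Cutting a forest of the bottleneck graph at the bridge *)

Section Bridge.
Variables (R : realType) (n m : nat) (b1 : 'I_n) (b2 : 'I_m) (w q : R).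
Implicit Types (t : option bool).
Local Notation map1 := {ffun 'I_n -> option 'I_n}.
Local Notation map2 := {ffun 'I_m -> option 'I_m}.
Local Notation V := ('I_n + 'I_m)%type.
Implicit Types (g : map1) (h : map2) (f : {ffun V -> option V}).
Implicit Types (phi : {ffun V -> option V} -> R).

(** [t] tells whether the bridge is used and from which side it is left. *)
Definition glue t g h : {ffun V -> option V} :=
  [ffun v => match v with
   | inl i => if (t == Some true) && (i == b1) then Some (inr b2)
              else omap inl (g i)
   | inr j => if (t == Some false) && (j == b2) then Some (inl b1)
              else omap inr (h j)
   end].

(** Only a root of its own clique can leave through the bridge. *)
Definition bridge_root t g h :=
  match t with
  | None => true
  | Some true => g b1 == None
  | Some false => h b2 == None
  end.

Definition bridge_use f : option bool :=
  if f (inl b1) == Some (inr b2) then Some true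
  else if f (inr b2) == Some (inl b1) then Some false else None.

Definition cut1 f : map1 :=
  [ffun i => if f (inl i) is Some (inl j) then Some j else None].

Definition cut2 f : map2 :=
  [ffun i => if f (inr i) is Some (inr j) then Some j else None].

Lemma bridge_use_glue t g h : bridge_use (glue t g h) = t.
Proof.
rewrite /bridge_use !ffunE !eqxx !andbT.
by case: t => [[]|] /=; rewrite ?eqxx //; case: (g b1) => [?|] //=;
  rewrite ?eqxx //; case: (h b2).
Qed.

Lemma glue_cut1 t g h : bridge_root t g h -> cut1 (glue t g h) = g.
Proof.
move=> rt; apply/ffunP => i; rewrite !ffunE.
case: ifP => [/andP[/eqP et /eqP ->]|_].
  by move: rt; rewrite et => /eqP.
by case: (g i).
Qed.

Lemma glue_cut2 t g h : bridge_root t g h -> cut2 (glue t g h) = h.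
Proof.
move=> rt; apply/ffunP => i; rewrite !ffunE.
case: ifP => [/andP[/eqP et /eqP ->]|_].
  by move: rt; rewrite et => /eqP.
by case: (h i).
Qed.

Lemma cut_bridge_root f : bridge_root (bridge_use f) (cut1 f) (cut2 f).
Proof.
rewrite /bridge_use; case: eqP => [fb|_] /=; first by rewrite ffunE fb.
by case: eqP => [fb|_] //=; rewrite ffunE fb.
Qed.

(** The clique that the bridge leads to is ranked below the other one. *)
Lemma acyclic_glue t g h : bridge_root t g h ->
  acyclic (glue t g h) = acyclic g && acyclic h.
Proof.
move=> rt; apply/acyclicP/andP => [[rank rank_lt]|].
  split; apply/acyclicP.
    exists (fun i => rank (inl i)) => i j fi; apply: rank_lt; rewrite ffunE fi.
    case: andP => // -[/eqP et /eqP ei].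
    by move: rt; rewrite et /= -ei fi.
  exists (fun i => rank (inr i)) => i j fi; apply: rank_lt; rewrite ffunE fi.
  case: andP => // -[/eqP et /eqP ei].
  by move: rt; rewrite et /= -ei fi.
case=> /acyclicP[rank1 lt1] /acyclicP[rank2 lt2].
exists (fun v => match v with
  | inl i => rank1 i + (if t == Some true then (rank2 b2).+1 else 0)
  | inr j => rank2 j + (if t == Some false then (rank1 b1).+1 else 0)
  end)%N => -[i|j] v; rewrite ffunE.
  case: andP => [[/eqP -> _] [<-]|_] /=; first by rewrite addn0 addnS ltnS leq_addl.
  by case fi: (g i) => [i'|//] [<-]; rewrite ltn_add2r lt1.
case: andP => [[/eqP -> _] [<-]|_] /=; first by rewrite addn0 addnS ltnS leq_addl.
by case fj: (h j) => [j'|//] [<-]; rewrite ltn_add2r lt2.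
Qed.

Definition glued_root t g h (v : V) : V :=
  match v with
  | inl i => if (t == Some true) && (tree_root g i == b1)
             then inr (tree_root h b2) else inl (tree_root g i)
  | inr j => if (t == Some false) && (tree_root h j == b2)
             then inl (tree_root g b1) else inr (tree_root h j)
  end.

Lemma tree_root_glue t g h v :
  bridge_root t g h -> acyclic g -> acyclic h ->
  tree_root (glue t g h) v = glued_root t g h v.
Proof.
move=> rt ac1 ac2; apply: tree_root_unique.
- by rewrite acyclic_glue ?ac1.
- move=> [i|j]; rewrite ffunE /=; case: andP => // tb.
    case fi: (g i) => [//|] _; rewrite tree_rootE //.
    by case: andP.
  case fj: (h j) => [//|] _; rewrite tree_rootE //.
  by case: andP.
move=> [i|j] v'; rewrite ffunE /=; case: andP => [[/eqP et /eqP ->] [<-]|tb] /=.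
- by move: rt; rewrite et /= => /eqP fb; rewrite tree_rootE // eqxx.
- by case fi: (g i) => [i'|//] [<-]; rewrite (tree_root_step ac1 fi).
- by move: rt; rewrite et /= => /eqP fb; rewrite tree_rootE // eqxx.
by case fj: (h j) => [j'|//] [<-]; rewrite (tree_root_step ac2 fj).
Qed.

Section SameTree.
Variables (t : option bool) (g : map1) (h : map2).
Hypotheses (rt : bridge_root t g h) (ac1 : acyclic g) (ac2 : acyclic h).
Local Notation root := (tree_root (glue t g h)).

(** If both roots were moved through the bridge, both were the same vertex. *)
Lemma same_tree_left i i' :
  (root (inl i) == root (inl i')) = (tree_root g i == tree_root g i').
Proof.
rewrite !tree_root_glue //=; case: (t =P Some true) => //= _.
case e: (tree_root g i == b1); case e': (tree_root g i' == b1) => //.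
- by rewrite eqxx (eqP e) (eqP e') eqxx.
- by rewrite (eqP e) [RHS]eq_sym e'.
by rewrite (eqP e') e.
Qed.

Lemma same_tree_right j j' :
  (root (inr j) == root (inr j')) = (tree_root h j == tree_root h j').
Proof.
rewrite !tree_root_glue //=; case: (t =P Some false) => //= _.
case e: (tree_root h j == b2); case e': (tree_root h j' == b2) => //.
- by rewrite eqxx (eqP e) (eqP e') eqxx.
- by rewrite (eqP e) [RHS]eq_sym e'.
by rewrite (eqP e') e.
Qed.

Lemma same_tree_across i j :
  (root (inl i) == root (inr j)) =
  [&& t != None, tree_root g i == tree_root g b1 &
      tree_root h j == tree_root h b2].
Proof.
rewrite !tree_root_glue //=; case: t rt => [[]|] //= /eqP fb.
  by rewrite (tree_rootE fb); case: (_ == b1) => //; exact: eq_sym.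
by rewrite (tree_rootE fb) andbC; case: (_ == b2).
Qed.

End SameTree.

Local Notation W := (parent_weight (bg_edges b1 b2) (bg_weight w) q).

Lemma weight_left (i : 'I_n) (o : option V) : W (inl i) o =
  match o with
  | None => q
  | Some (inl i') => if i != i' then 1 else 0
  | Some (inr j) => if (i == b1) && (j == b2) then w else 0
  end.
Proof. by case: o => [[i'|j]|] //=; rewrite inE. Qed.

Lemma weight_right (j : 'I_m) (o : option V) : W (inr j) o =
  match o with
  | None => q
  | Some (inl i) => if (i == b1) && (j == b2) then w else 0
  | Some (inr j') => if j != j' then 1 else 0
  end.
Proof. by case: o => [[i'|j']|] //=; rewrite inE. Qed.

(** A map of nonzero weight crosses between the cliques only along the bridge,
    and an acyclic map does so in one direction only. *)
Lemma cut_glue f : acyclic f -> \prod_z W z (f z) != 0 ->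
  glue (bridge_use f) (cut1 f) (cut2 f) = f.
Proof.
move=> acf /prodf_neq0 Wf; apply/ffunP => -[i|j]; rewrite !ffunE /=.
  have := Wf (inl i) isT; rewrite weight_left.
  case fi: (f (inl i)) => [[i'|j]|] //=.
  - move=> _; case: andP => // -[/eqP]; rewrite /bridge_use.
    case: eqP => [fb _ /eqP ei|_]; last by case: ifP.
    by rewrite ei fb in fi.
  - case: andP => [[/eqP ei /eqP ej] _|]; last by rewrite eqxx.
    by rewrite -ei -ej /bridge_use -ei -ej fi !eqxx.
  move=> _; case: andP => // -[/eqP]; rewrite /bridge_use.
  case: eqP => [fb _ /eqP ei|_]; last by case: ifP.
  by rewrite ei fb in fi.
have := Wf (inr j) isT; rewrite weight_right.
case fj: (f (inr j)) => [[i|j']|] //=.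
- case: andP => [[/eqP ei /eqP ej] _|]; last by rewrite eqxx.
  rewrite ei ej in fj *; rewrite /bridge_use fj eqxx.
  case: (f (inl b1) =P Some (inr b2)) => [fb|_]; last by rewrite !eqxx.
  by have := acyclic_no_loop acf (parent_fconnect fb) fj.
- move=> _; case: andP => // -[/eqP]; rewrite /bridge_use.
  case: eqP => // _; case: eqP => [fb _ /eqP ej|//].
  by rewrite ej fb in fj.
move=> _; case: andP => // -[/eqP]; rewrite /bridge_use.
case: eqP => // _; case: eqP => [fb _ /eqP ej|//].
by rewrite ej fb in fj.
Qed.

Lemma weight_glue_left t g h : acyclic g ->
  \prod_i W (inl i) (glue t g h (inl i)) =
  if t == Some true then w * free_weight q [set b1]%SET g
  else free_weight q finset.set0 g.
Proof.
move=> ac1.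
have inner i : ~~ ((t == Some true) && (i == b1)) ->
    W (inl i) (glue t g h (inl i)) = if g i is Some _ then 1 else q.
  rewrite weight_left ffunE => /negPf ->.
  by case fi: (g i) => [i'|] //=; rewrite (acyclic_neq ac1 fi).
case: eqP => et.
  rewrite (bigD1 b1) //= weight_left ffunE et !eqxx /= !eqxx.
  rewrite -et; congr (_ * _); apply: eq_big => i; first by rewrite inE.
  by move=> ib; rewrite inner // negb_and ib orbT.
apply: eq_big => [i|i _]; first by rewrite inE.
by apply: inner; rewrite (introF eqP et).
Qed.

Lemma weight_glue_right t g h : acyclic h ->
  \prod_j W (inr j) (glue t g h (inr j)) =
  if t == Some false then w * free_weight q [set b2]%SET h
  else free_weight q finset.set0 h.
Proof.
move=> ac2.
have inner i : ~~ ((t == Some false) && (i == b2)) ->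
    W (inr i) (glue t g h (inr i)) = if h i is Some _ then 1 else q.
  rewrite weight_right ffunE => /negPf ->.
  by case fi: (h i) => [i'|] //=; rewrite (acyclic_neq ac2 fi).
case: eqP => et.
  rewrite (bigD1 b2) //= weight_right ffunE et !eqxx /= !eqxx.
  rewrite -et; congr (_ * _); apply: eq_big => i; first by rewrite inE.
  by move=> ib; rewrite inner // negb_and ib orbT.
apply: eq_big => [i|i _]; first by rewrite inE.
by apply: inner; rewrite (introF eqP et).
Qed.

Definition bg_sum phi : R :=
  \sum_(f | acyclic f) (\prod_z W z (f z)) * phi f.

(** The decomposition at the bridge, for observables that factor over the two
    cliques. *)
Lemma bg_sum_split phi
    (psi1 : option bool -> map1 -> R)
    (psi2 : option bool -> map2 -> R) :
  (forall t g h, bridge_root t g h -> acyclic g -> acyclic h ->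
     phi (glue t g h) = psi1 t g * psi2 t h) ->
  bg_sum phi =
  clique_sum q (psi1 None) * clique_sum q (psi2 None) +
  w * rooted_sum q b1 (psi1 (Some true)) * clique_sum q (psi2 (Some true)) +
  w * clique_sum q (psi1 (Some false)) * rooted_sum q b2 (psi2 (Some false)).
Proof.
move=> phiE; rewrite /bg_sum (bigID (fun f =>
  glue (bridge_use f) (cut1 f) (cut2 f) == f)) /= [X in _ + X]big1 ?addr0;
  last first.
  move=> f /andP[acf]; case: (eqVneq (\prod_z W z (f z)) 0) => [->|nz].
    by rewrite mul0r.
  by rewrite cut_glue ?eqxx.
pose F (t : option bool) (ff : map1 * map2) := \prod_z W z (glue t ff.1 ff.2 z) *
    phi (glue t ff.1 ff.2).
rewrite (reindex_onto (fun p : option bool * (map1 * map2) => glue p.1 p.2.1 p.2.2)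
   (fun f => (bridge_use f, (cut1 f, cut2 f)))) /=; last first.
  by move=> f /andP[_ /eqP].
rewrite (eq_bigl (fun p : option bool * (map1 * map2) =>
    bridge_root p.1 p.2.1 p.2.2 &&
    (acyclic p.2.1 && acyclic p.2.2))); last first.
  move=> [t [g h]] /=; rewrite !xpair_eqE bridge_use_glue eqxx /=.
  have [rt|nrt] := boolP (bridge_root t g h).
    by rewrite glue_cut1 // glue_cut2 // !eqxx !andbT acyclic_glue.
  apply/negbTE; rewrite negb_and; apply/orP; right.
  apply: contra nrt => /andP[/eqP e1 /eqP e2].
  by have := cut_bridge_root (glue t g h); rewrite bridge_use_glue e1 e2.
rewrite big_mkcond -(pair_bigA _ (fun t ff =>
  if bridge_root t ff.1 ff.2 && (acyclic ff.1 && acyclic ff.2) then F t ff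
  else 0)) /= big_option big_bool /= addrA.
have FE t g h : bridge_root t g h -> acyclic g -> acyclic h ->
    F t (g, h) =
    (if t == Some true then w * free_weight q [set b1]%SET g
     else free_weight q finset.set0 g) *
    (if t == Some false then w * free_weight q [set b2]%SET h
     else free_weight q finset.set0 h) * (psi1 t g * psi2 t h).
  move=> rt ac1 ac2; rewrite /F /= phiE // big_sumType /=.
  by rewrite weight_glue_left // weight_glue_right.
rewrite -!big_mkcond /clique_sum /rooted_sum; congr (_ + _ + _).
- rewrite big_distrlr pair_big; apply: eq_big => // -[g h] /andP[ac1 ac2].
  by rewrite FE //=; ring.
- rewrite -mulrA big_distrlr pair_big mulr_sumr; apply: eq_big => [[g h]|[g h]].
    by rewrite /= -andbA andbCA.
  by case/and3P=> rt ac1 ac2; rewrite FE //=; ring.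
rewrite -mulrA big_distrlr pair_big mulr_sumr; apply: eq_big => [[g h]|[g h]].
  by rewrite /= andbC andbA.
by case/and3P=> rt ac1 ac2; rewrite FE //=; ring.
Qed.
End Bridge.

(** * Partition function and correlations as mixtures *)

(** The weight of the forests that leave the clique on [N] vertices through the
    bridge, relative to those that do not use the bridge. *)
Definition bridge_odds (R : realType) (w q N : R) : R :=
  w * (q + 1) / (q * (q + N)).

(** The separation probability of two vertices of one clique: [x] in its free
    forest, [y] if the end of the bridge is conditioned to be a root, which
    happens with odds [a]; the odds [b] of the opposite direction leave the
    forest of this clique free. *)
Definition mixture (R : realType) (a b x y : R) : R :=
  ((1 + b) * x + a * y) / (1 + a + b).

Section BridgeFormulas.
Variables (R : realType) (n m : nat) (b1 : 'I_n) (b2 : 'I_m).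
Implicit Types (w q : R).
Local Notation V := ('I_n + 'I_m)%type.
Implicit Types (u v : V).

Lemma bg_Z_sum w q : bg_Z b1 b2 w q = bg_sum b1 b2 w q (fun=> 1).
Proof.
rewrite /bg_Z partition_functionE /bg_sum.
by apply: eq_bigr => f _; rewrite mulr1.
Qed.

Lemma bg_U_sum w q u v : bg_U b1 b2 w q u v =
  bg_sum b1 b2 w q (fun f => (tree_root f u != tree_root f v)%:R) /
  bg_sum b1 b2 w q (fun=> 1).
Proof. by rewrite /bg_U two_point_correlationE -bg_Z_sum. Qed.

Lemma bg_U_sym w q u v : bg_U b1 b2 w q u v = bg_U b1 b2 w q v u.
Proof.
rewrite !bg_U_sum; congr (_ / _); apply: eq_bigr => f _.
by rewrite eq_sym.
Qed.

Local Notation total1 q := (clique_sum q (fun _ : {ffun 'I_n -> option 'I_n} => 1)).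
Local Notation total2 q := (clique_sum q (fun _ : {ffun 'I_m -> option 'I_m} => 1)).
Local Notation rooted1 q := (rooted_sum q b1 (fun=> 1)).
Local Notation rooted2 q := (rooted_sum q b2 (fun=> 1)).

Lemma bg_sum1 w q : bg_sum b1 b2 w q (fun=> 1) =
  total1 q * total2 q + w * rooted1 q * total2 q + w * total1 q * rooted2 q.
Proof.
rewrite (bg_sum_split _ _ (psi1 := fun _ _ => 1) (psi2 := fun _ _ => 1)) //.
by move=> *; rewrite mulr1.
Qed.

Lemma bg_ZE w q :
  (1 < n)%N \/ q + n%:R != 0 -> (1 < m)%N \/ q + m%:R != 0 ->
  bg_Z b1 b2 w q =
    q * (q * (q + n%:R) * (q + m%:R) + w * (q + 1) * (2 * q + n%:R + m%:R))
      * (q + n%:R) ^ (n%:Z - 2) * (q + m%:R) ^ (m%:Z - 2).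
Proof.
move=> okn okm; rewrite bg_Z_sum bg_sum1.
have ok1 : (1 < #|'I_n|)%N \/ q + #|'I_n|%:R != 0 by rewrite card_ord.
have ok2 : (1 < #|'I_m|)%N \/ q + #|'I_m|%:R != 0 by rewrite card_ord.
rewrite (clique_sumZ ok1 b1) (clique_sumZ ok2 b2).
rewrite (rooted_sumZ ok1 b1) (rooted_sumZ ok2 b2) !card_ord.
by ring.
Qed.

Section Ratios.
Variables (w q : R).

Lemma bridge_odds_ge0 N : 0 <= w -> 0 < q -> 0 <= N -> 0 <= bridge_odds w q N.
Proof.
move=> w0 q0 N0; apply: divr_ge0; apply: mulr_ge0 => //; lra.
Qed.

Lemma total1_gt0 : 0 < q -> 0 < total1 q.
Proof.
move=> q0; have qn : 0 < q + n%:R by apply: ltr_wpDr.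
rewrite (@clique_sumZ _ _ q _ b1) ?card_ord; last by right; rewrite gt_eqF.
by rewrite !mulr_gt0 // exprz_gt0.
Qed.

Lemma total2_gt0 : 0 < q -> 0 < total2 q.
Proof.
move=> q0; have qn : 0 < q + m%:R by apply: ltr_wpDr.
rewrite (@clique_sumZ _ _ q _ b2) ?card_ord; last by right; rewrite gt_eqF.
by rewrite !mulr_gt0 // exprz_gt0.
Qed.

Lemma rooted1_odds : 0 < q -> w * rooted1 q = bridge_odds w q n%:R * total1 q.
Proof.
move=> q0; have qn : 0 < q + n%:R by apply: ltr_wpDr.
have ok : (1 < #|'I_n|)%N \/ q + #|'I_n|%:R != 0.
  by right; rewrite card_ord gt_eqF.
rewrite (clique_sumZ ok b1) (rooted_sumZ ok b1) card_ord /bridge_odds.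
by field; rewrite !gt_eqF.
Qed.

Lemma rooted2_odds : 0 < q -> w * rooted2 q = bridge_odds w q m%:R * total2 q.
Proof.
move=> q0; have qn : 0 < q + m%:R by apply: ltr_wpDr.
have ok : (1 < #|'I_m|)%N \/ q + #|'I_m|%:R != 0.
  by right; rewrite card_ord gt_eqF.
rewrite (clique_sumZ ok b2) (rooted_sumZ ok b2) card_ord /bridge_odds.
by field; rewrite !gt_eqF.
Qed.

Lemma bg_sum1_odds : 0 < q -> bg_sum b1 b2 w q (fun=> 1) =
  (1 + bridge_odds w q n%:R + bridge_odds w q m%:R) * (total1 q * total2 q).
Proof.
move=> q0; rewrite bg_sum1 rooted1_odds // -[w * _ * _]mulrA.
by rewrite mulrCA rooted2_odds //; ring.
Qed.

Lemma bg_U_left (i i' : 'I_n) x y : 0 <= w -> 0 < q ->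
  clique_sum q (fun g : {ffun 'I_n -> option 'I_n} =>
    (tree_root g i != tree_root g i')%:R) = total1 q * x ->
  rooted_sum q b1 (fun g : {ffun 'I_n -> option 'I_n} =>
    (tree_root g i != tree_root g i')%:R) = rooted1 q * y ->
  bg_U b1 b2 w q (inl i) (inl i') =
    mixture (bridge_odds w q n%:R) (bridge_odds w q m%:R) x y.
Proof.
move=> w0 q0 hx hy; rewrite bg_U_sum bg_sum1_odds //.
rewrite (bg_sum_split _ _ (psi1 := fun _ g => (tree_root g i != tree_root g i')%:R)
  (psi2 := fun _ _ => 1)) => [|t g h rt ac1 ac2]; last first.
  by rewrite mulr1 same_tree_left.
rewrite hx hy [w * (_ * y)]mulrA rooted1_odds // -[w * _ * rooted2 _]mulrA.
rewrite [w * (_ * rooted2 _)]mulrCA rooted2_odds // /mixture.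
have := total1_gt0 q0; have := total2_gt0 q0.
have := @bridge_odds_ge0 n%:R w0 q0 (ler0n _ _).
have := @bridge_odds_ge0 m%:R w0 q0 (ler0n _ _).
move=> r1 r2 t1 t2; field; rewrite !gt_eqF //; lra.
Qed.

Lemma bg_U_right (i i' : 'I_m) x y : 0 <= w -> 0 < q ->
  clique_sum q (fun g : {ffun 'I_m -> option 'I_m} =>
    (tree_root g i != tree_root g i')%:R) = total2 q * x ->
  rooted_sum q b2 (fun g : {ffun 'I_m -> option 'I_m} =>
    (tree_root g i != tree_root g i')%:R) = rooted2 q * y ->
  bg_U b1 b2 w q (inr i) (inr i') =
    mixture (bridge_odds w q m%:R) (bridge_odds w q n%:R) x y.
Proof.
move=> w0 q0 hx hy; rewrite bg_U_sum bg_sum1_odds //.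
rewrite (bg_sum_split _ _ (psi1 := fun _ _ => 1)
  (psi2 := fun _ g => (tree_root g i != tree_root g i')%:R))
  => [|t g h rt ac1 ac2]; last first.
  by rewrite mul1r same_tree_right.
rewrite hx hy rooted1_odds // -[w * _ * (rooted2 _ * y)]mulrA.
rewrite [w * (_ * (rooted2 _ * y))]mulrCA [w * (_ * y)]mulrA rooted2_odds // /mixture.
have := total1_gt0 q0; have := total2_gt0 q0.
have := @bridge_odds_ge0 n%:R w0 q0 (ler0n _ _).
have := @bridge_odds_ge0 m%:R w0 q0 (ler0n _ _).
move=> r1 r2 t1 t2; field; rewrite !gt_eqF //; lra.
Qed.

(** The variables [x], [y], [x'], [y'] are probabilities of being in the tree
    of the end of the bridge; without the bridge the cliques are separated, so
    that there is no term for that case. *)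
Lemma bg_U_across (i : 'I_n) (j : 'I_m) x x' y y' : 0 <= w -> 0 < q ->
  clique_sum q (fun g : {ffun 'I_n -> option 'I_n} =>
    (tree_root g i == tree_root g b1)%:R) = total1 q * x ->
  rooted_sum q b1 (fun g : {ffun 'I_n -> option 'I_n} =>
    (tree_root g i == tree_root g b1)%:R) = rooted1 q * y ->
  clique_sum q (fun g : {ffun 'I_m -> option 'I_m} =>
    (tree_root g j == tree_root g b2)%:R) = total2 q * x' ->
  rooted_sum q b2 (fun g : {ffun 'I_m -> option 'I_m} =>
    (tree_root g j == tree_root g b2)%:R) = rooted2 q * y' ->
  1 - bg_U b1 b2 w q (inl i) (inr j) =
  (bridge_odds w q n%:R * y * x' + bridge_odds w q m%:R * x * y') /
  (1 + bridge_odds w q n%:R + bridge_odds w q m%:R).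
Proof.
move=> w0 q0 hx hy hx' hy'.
have t1 := total1_gt0 q0; have t2 := total2_gt0 q0.
have r1 := @bridge_odds_ge0 n%:R w0 q0 (ler0n _ _).
have r2 := @bridge_odds_ge0 m%:R w0 q0 (ler0n _ _).
have Z0 : bg_sum b1 b2 w q (fun=> 1) != 0.
  by rewrite bg_sum1_odds // mulf_neq0 ?gt_eqF ?mulr_gt0 //; lra.
have -> : 1 - bg_U b1 b2 w q (inl i) (inr j) = bg_sum b1 b2 w q (fun f =>
    (tree_root f (inl i) == tree_root f (inr j))%:R) /
    bg_sum b1 b2 w q (fun=> 1).
  rewrite bg_U_sum -{1}(divff Z0) -mulrBl; congr (_ / _).
  rewrite /bg_sum -sumrB; apply: eq_bigr => f _.
  by rewrite -mulrBr; case: (_ == _); rewrite /= ?subr0 ?subrr.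
rewrite (bg_sum_split _ _
  (psi1 := fun t g => ((t != None) && (tree_root g i == tree_root g b1))%:R)
  (psi2 := fun _ h => (tree_root h j == tree_root h b2)%:R))
  => [|t g h rt ac1 ac2]; last first.
  by rewrite same_tree_across // andbA -natrM mulnb.
rewrite /= {1}/clique_sum big1 ?mul0r ?add0r; last by move=> *; rewrite mulr0.
rewrite hx hy hx' hy' bg_sum1_odds // [w * (_ * y)]mulrA rooted1_odds //.
rewrite -[w * _ * (rooted2 _ * y')]mulrA [w * (_ * (rooted2 _ * y'))]mulrCA.
rewrite [w * (_ * y')]mulrA rooted2_odds //.
by field; rewrite !gt_eqF //; lra.
Qed.

End Ratios.

Lemma card_bg_clique i : #|bg_clique n m i| = if i then n else m.
Proof.
rewrite -[in RHS](card_ord n) -[in RHS](card_ord m).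
case: i; [rewrite -(card_imset _ (@inl_inj 'I_n 'I_m)) |
          rewrite -(card_imset _ (@inr_inj 'I_n 'I_m))];
  apply: eq_card => -[k|k]; rewrite !inE /=.
- by rewrite mem_imset //; exact: inl_inj.
- by apply/esym/negbTE/negP => /imsetP[].
- by apply/esym/negbTE/negP => /imsetP[].
by rewrite mem_imset //; exact: inr_inj.
Qed.

End BridgeFormulas.

Section PairFormulas.
Variables (R : realType) (n m : nat) (b1 : 'I_n) (b2 : 'I_m) (w q : R).
Local Notation V := ('I_n + 'I_m)%type.
Implicit Types (u v : V) (i : bool).
Local Notation U := (bg_U b1 b2 w q).

Definition side (k l : nat) i : R := (if i then k else l)%:R.

Local Notation bridge_odds_of i := (bridge_odds w q (side n m i)).

Lemma mem_bg_inner i u : (u \in bg_inner b1 b2 i) =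
  match u with
  | inl j => i && (j != b1)
  | inr j => ~~ i && (j != b2)
  end.
Proof. by rewrite !inE; case: u i => [j|j] []; rewrite ?andbT ?andbF. Qed.

Lemma bg_U_xx' i u v : 0 <= w -> 0 < q -> pair_xx' i b1 b2 u v ->
  exists x y, [/\ apart_bounds q (side n m i) x, apart_bounds q (side n m i) y &
    U u v = mixture (bridge_odds_of i) (bridge_odds_of (~~ i)) x y].
Proof.
move=> w0 q0; rewrite /pair_xx' !mem_bg_inner.
case: i u v => [] [u|u] [v|v] //=; rewrite ?andbF // => /and3P[ub vb uv];
  have {}uv : u != v := uv.
  have [x xB hx] := clique_apart q0 uv.
  have [y yB hy] := rooted_apart2 q0 ub vb uv.
  rewrite card_ord in xB yB; exists x, y; split=> //.
  exact: bg_U_left.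
have [x xB hx] := clique_apart q0 uv.
have [y yB hy] := rooted_apart2 q0 ub vb uv.
rewrite card_ord in xB yB; exists x, y; split=> //.
exact: bg_U_right.
Qed.

Lemma bg_U_bx i u v : 0 <= w -> 0 < q -> pair_bx i b1 b2 u v ->
  exists2 x, apart_bounds q (side n m i) x &
    U u v = mixture (bridge_odds_of i) (bridge_odds_of (~~ i)) x (q / (q + 1)).
Proof.
move=> w0 q0 /andP[/eqP -> ]; rewrite mem_bg_inner.
case: i v => [] [v|v] //= vb; have bv := vb; rewrite eq_sym in bv.
  have [x xB hx] := clique_apart q0 bv.
  rewrite card_ord in xB; exists x => //.
  apply: bg_U_left => //; exact: rooted_apart.
have [x xB hx] := clique_apart q0 bv.
rewrite card_ord in xB; exists x => //.
apply: bg_U_right => //; exact: rooted_apart.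
Qed.

Lemma sum_together (T : finType) (f : {ffun T -> option T} -> R) D phi (x y : T) :
  \sum_(g | D g) f g * (tree_root g x != tree_root g y)%:R =
    (\sum_(g | D g) f g * 1) * phi ->
  \sum_(g | D g) f g * (tree_root g x == tree_root g y)%:R =
    (\sum_(g | D g) f g * 1) * (1 - phi).
Proof.
move=> H; rewrite mulrBr mulr1 -H -sumrB; apply: eq_bigr => g _.
by rewrite -mulrBr; case: (_ == _); rewrite /= ?subr0 ?subrr.
Qed.

Lemma clique_together (T : finType) (y z : T) x :
  clique_sum q (fun g : {ffun T -> option T} =>
    (tree_root g y != tree_root g z)%:R) =
    clique_sum q (fun _ : {ffun T -> option T} => 1) * x ->
  clique_sum q (fun g : {ffun T -> option T} =>
    (tree_root g y == tree_root g z)%:R) =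
    clique_sum q (fun _ : {ffun T -> option T} => 1) * (1 - x).
Proof. exact: sum_together. Qed.

Lemma rooted_together (T : finType) (b y z : T) x :
  rooted_sum q b (fun g : {ffun T -> option T} =>
    (tree_root g y != tree_root g z)%:R) = rooted_sum q b (fun=> 1) * x ->
  rooted_sum q b (fun g : {ffun T -> option T} =>
    (tree_root g z == tree_root g y)%:R) = rooted_sum q b (fun=> 1) * (1 - x).
Proof.
move=> /sum_together H; apply: etrans H; rewrite /rooted_sum.
by apply: eq_bigr => g _; rewrite eq_sym.
Qed.

Lemma bg_U_bb' i u v : 0 <= w -> 0 < q -> pair_bb' i b1 b2 u v ->
  U u v = 1 / (1 + bridge_odds w q n%:R + bridge_odds w q m%:R).
Proof.
move=> w0 q0 /andP[/eqP -> /eqP ->].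
have r1 := @bridge_odds_ge0 _ w q n%:R w0 q0 (ler0n _ _).
have r2 := @bridge_odds_ge0 _ w q m%:R w0 q0 (ler0n _ _).
suff H : 1 - U (inl b1) (inr b2) = (bridge_odds w q n%:R + bridge_odds w q m%:R) /
    (1 + bridge_odds w q n%:R + bridge_odds w q m%:R).
  have -> : U (bg_end b1 b2 i) (bg_end b1 b2 (~~ i)) = U (inl b1) (inr b2).
    by case: i => //; rewrite bg_U_sym.
  rewrite -[LHS](subKr 1) H; field; lra.
rewrite (@bg_U_across _ _ _ _ _ _ _ _ _ 1 1 1 1) ?mulr1 //;
  by rewrite /clique_sum /rooted_sum; apply: eq_bigr => f _; rewrite eqxx.
Qed.

Lemma bg_U_xy i u v : 0 <= w -> 0 < q -> pair_xy i b1 b2 u v ->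
  exists x x', [/\ apart_bounds q n%:R x, apart_bounds q m%:R x' &
    1 - U u v = (bridge_odds w q n%:R * (1 - x') + bridge_odds w q m%:R * (1 - x)) /
    ((1 + bridge_odds w q n%:R + bridge_odds w q m%:R) * (q + 1))].
Proof.
move=> w0 q0.
have r1 := @bridge_odds_ge0 _ w q n%:R w0 q0 (ler0n _ _).
have r2 := @bridge_odds_ge0 _ w q m%:R w0 q0 (ler0n _ _).
suff main j k : j != b1 -> k != b2 ->
    exists x x', [/\ apart_bounds q n%:R x, apart_bounds q m%:R x' &
    1 - U (inl j) (inr k) =
    (bridge_odds w q n%:R * (1 - x') + bridge_odds w q m%:R * (1 - x)) /
    ((1 + bridge_odds w q n%:R + bridge_odds w q m%:R) * (q + 1))].
  rewrite /pair_xy !mem_bg_inner.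
  case: i u v => [] [u|u] [v|v] //=; rewrite ?andbF // => /andP[ub vb].
    exact: main.
  by rewrite bg_U_sym; exact: main.
move=> jb kb.
have [x xB hx] := clique_apart q0 jb.
have [x' xB' hx'] := clique_apart q0 kb.
have hy := rooted_apart q0 jb; have hy' := rooted_apart q0 kb.
rewrite card_ord in xB; rewrite card_ord in xB'.
exists x, x'; split=> //.
rewrite (bg_U_across w0 q0 (clique_together hx) (rooted_together hy)
  (clique_together hx') (rooted_together hy')).
by field; rewrite !gt_eqF //; lra.
Qed.

End PairFormulas.

Section Estimates.
Variable R : realType.
Implicit Types (q w e k l a b x y N : R).

Lemma apart_bounds_small q N x e : 0 < q -> 1 <= N -> 0 < e -> apart_bounds q N x ->
  q <= e * Num.sqrt N -> x <= 4 * e.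
Proof.
move=> q0 N1 e0 [_ _ xN _] qN.
have sN : 0 < Num.sqrt N by rewrite sqrtr_gt0; lra.
by rewrite -(ler_pM2r sN); lra.
Qed.

Lemma apart_bounds_large q N x e : 0 < q -> 1 <= N -> 0 < e <= 1 ->
  apart_bounds q N x -> Num.sqrt N <= e * q -> 1 - x <= 4 * e.
Proof.
move=> q0 N1 /andP[e0 e1] [_ _ _ xN] Nq.
have s1 : 1 <= Num.sqrt N by rewrite -sqrtr1 ler_wsqrtr.
have sN : Num.sqrt N ^+ 2 = N by rewrite sqr_sqrtr; lra.
have h1 : 3 / q <= 3 * e by rewrite ler_pdivrMr //; lra.
have h2 : N / q ^+ 2 <= e.
  rewrite ler_pdivrMr ?exprn_gt0 // -sN.
  have h : Num.sqrt N ^+ 2 <= (e * q) ^+ 2.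
    by apply: lerXn2r; rewrite // nnegrE; lra.
  apply: le_trans h _; rewrite exprMn ler_wpM2r ?sqr_ge0 //.
  by rewrite expr2; nra.
lra.
Qed.

Lemma mixture_le a b x y c : 0 <= a -> 0 <= b -> x <= c -> y <= c ->
  mixture a b x y <= c.
Proof. by move=> a0 b0 xc yc; rewrite /mixture ler_pdivrMr; nra. Qed.

Lemma le_mixture a b x y c : 0 <= a -> 0 <= b -> c <= x -> c <= y ->
  c <= mixture a b x y.
Proof. by move=> a0 b0 xc yc; rewrite /mixture ler_pdivlMr; nra. Qed.

Lemma bridge_odds_sum_ge k l w q : 0 <= w -> 0 < q -> 0 < l -> 0 <= k ->
  w * (q + 1) / (q * (q + l)) <= bridge_odds w q k + bridge_odds w q l.
Proof.
by move=> w0 q0 l0 k0; rewrite {2}/bridge_odds lerDr; apply: bridge_odds_ge0.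
Qed.

Lemma bridge_odds_anti k l w q : 0 <= w -> 0 < q -> 0 < l <= k ->
  bridge_odds w q k <= bridge_odds w q l.
Proof.
move=> w0 q0 /andP[l0 lk]; rewrite /bridge_odds; apply: ler_wpM2l.
  by apply: mulr_ge0 => //; lra.
by rewrite lef_pV2 ?posrE ?ler_pM2l ?mulr_gt0 //; lra.
Qed.

End Estimates.

(** * Limits *)

(** Two-sided estimates of the odds of the bridge being used, in terms of the
    size [l] of the smaller clique: up to a factor 2, they are
    [w (1 + 1 / q) / (q + l)]. *)
Section BridgeOdds.
Variable R : realType.
Variables w q k l : R.
Local Notation r := (bridge_odds w q k + bridge_odds w q l).

Lemma odds_ge_small : 0 <= w -> 0 < q -> 1 <= l <= k -> w / (q * l) <= r.
Proof.
move=> w0 q0 /andP[l1 lk]; apply: le_trans (bridge_odds_sum_ge w0 q0 _ _); try lra.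
rewrite ler_pdivrMr ?mulr_gt0 //; last by lra.
rewrite mulrAC ler_pdivlMr ?mulr_gt0 //; try lra.
rewrite -!mulrA; apply: ler_wpM2l => //.
by rewrite mulrCA; apply: ler_wpM2l; nra.
Qed.

Lemma odds_ge_large : 0 <= w -> 0 < q -> 1 <= l <= k -> w / (q + l) <= r.
Proof.
move=> w0 q0 /andP[l1 lk]; apply: le_trans (bridge_odds_sum_ge w0 q0 _ _); try lra.
rewrite ler_pdivrMr ?mulr_gt0 //; last by lra.
rewrite mulrAC ler_pdivlMr ?mulr_gt0 //; try lra.
rewrite -!mulrA; apply: ler_wpM2l => //.
by apply: ler_wpM2r; lra.
Qed.

Lemma odds_le_small : 0 <= w -> 0 < q -> 1 <= l <= k ->
  r <= 2 * (w / l + w / l / q).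
Proof.
move=> w0 q0 /andP[l1 lk]; have lk' : 0 < l <= k by lra.
have h := bridge_odds_anti w0 q0 lk'.
suff : bridge_odds w q l <= w / l + w / l / q by lra.
have -> : w / l + w / l / q = w * (q + 1) / (q * l) by field; lra.
rewrite /bridge_odds; apply: ler_wpM2l; first by apply: mulr_ge0 => //; lra.
by rewrite lef_pV2 ?posrE ?ler_pM2l ?mulr_gt0 //; lra.
Qed.

Lemma odds_le_large : 0 <= w -> 0 < q -> 1 <= l <= k -> r <= 2 * (w / q).
Proof.
move=> w0 q0 /andP[l1 lk]; have lk' : 0 < l <= k by lra.
have h := bridge_odds_anti w0 q0 lk'.
suff : bridge_odds w q l <= w / q by lra.
rewrite /bridge_odds ler_pdivrMr ?mulr_gt0 //; last by lra.
rewrite mulrAC ler_pdivlMr //.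
rewrite -!mulrA; apply: ler_wpM2l => //.
by rewrite mulrC; apply: ler_wpM2l; lra.
Qed.

End BridgeOdds.

Section Limits.
Variables (R : realType) (m : nat -> nat) (w q : nat -> R) (i : bool).
Hypothesis m_le : forall n, (0 < n)%N -> (0 < m n <= n)%N.
Hypothesis w_ge0 : forall n, 0 <= w n.
Hypothesis q_gt0 : forall n, 0 < q n.

Let C n : R := side R n (m n) i.
Let M n : R := (m n)%:R.
Let N n : R := n%:R.
Let odds n : R := bridge_odds (w n) (q n) n%:R + bridge_odds (w n) (q n) (M n).

Lemma littleo_le_pos (f g : nat -> R) : (forall n, 0 <= f n) ->
  (forall n, 0 <= g n) -> f =o_\oo g ->
  forall e : R, 0 < e -> \forall n \near \oo, f n <= e * g n.
Proof.
move=> f0 g0 /eqoP fg e e0; near=> n.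
have : `|f n| <= e * `|g n| by near: n; exact: fg.
by rewrite !ger0_norm.
Unshelve. all: by end_near. Qed.

Lemma U_cvg_le (kind : pair_kind) (c l : R) : 0 < c ->
  (forall e : R, 0 < e <= 1 -> \forall n \near \oo,
     forall (b1 : 'I_n) (b2 : 'I_(m n)) u v, kind n (m n) b1 b2 u v ->
     `|bg_U b1 b2 (w n) (q n) u v - l| <= c * e) ->
  U_cvg m w q kind l.
Proof.
move=> c0 H eps eps0; pose e := Num.min 1 (eps / (2 * c)).
have e0 : 0 < e by rewrite lt_min ltr01 divr_gt0 // mulr_gt0.
have ee : c * e <= eps / 2.
  have -> : eps / 2 = c * (eps / (2 * c)) by field; rewrite gt_eqF.
  by rewrite ler_pM2l // ge_min lexx orbT.
have := H e; rewrite e0 ge_min lexx => /(_ isT).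
apply: filterS => n Hn b1 b2 u v /Hn Huv.
by apply: le_lt_trans Huv _; lra.
Qed.

Lemma m_facts n : (0 < n)%N -> 1 <= M n <= N n.
Proof. by move=> /m_le; rewrite /M /N ler1n ler_nat. Qed.

Lemma sides n : C n + side R n (m n) (~~ i) = M n + N n.
Proof. by rewrite /C /side; case: i => //=; rewrite addrC. Qed.

Lemma C_facts n : (0 < n)%N -> 1 <= C n <= N n.
Proof.
move=> n0; have := m_facts n0; rewrite /C /side /M /N; case: i => //=.
by move=> _; rewrite lexx ler1n n0.
Qed.

Lemma oddsE n : bridge_odds (w n) (q n) (C n) +
  bridge_odds (w n) (q n) (side R n (m n) (~~ i)) =
  odds n.
Proof. by rewrite /odds /C /side; case: i => //=; rewrite addrC. Qed.

Lemma bridge_odds_side_ge0 n j : 0 <= bridge_odds (w n) (q n) (side R n (m n) j).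
Proof. by apply: bridge_odds_ge0. Qed.

Lemma sqrt_le_self (x : R) : 1 <= x -> Num.sqrt x <= x.
Proof.
move=> x1; have s1 : 1 <= Num.sqrt x by rewrite -sqrtr1 ler_wsqrtr.
have : Num.sqrt x ^+ 2 = x by rewrite sqr_sqrtr; lra.
by nra.
Qed.

Lemma norm_le0 (x c : R) : 0 <= x -> x <= c -> `|x - 0| <= c.
Proof. by move=> x0 xc; rewrite subr0 ger0_norm. Qed.

Lemma norm_le1 (x c : R) : x <= 1 -> 1 - x <= c -> `|x - 1| <= c.
Proof. by move=> x1 xc; rewrite distrC ger0_norm // subr_ge0. Qed.

Let sC n : R := Num.sqrt (C n).

Lemma sC_ge0 n : 0 <= sC n. Proof. exact: sqrtr_ge0. Qed.
Lemma q_ge0 n : 0 <= q n. Proof. exact: ltW. Qed.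
Lemma M_ge0 n : 0 <= M n. Proof. exact: ler0n. Qed.
Lemma N_ge0 n : 0 <= N n. Proof. exact: ler0n. Qed.
Lemma wM_ge0 n : 0 <= w n / M n. Proof. exact: divr_ge0. Qed.

Lemma cvg_xx'_0 : q =o_\oo sC -> U_cvg m w q (pair_xx' i) 0.
Proof.
move=> qs; apply: (@U_cvg_le _ 4) => // e /andP[e0 e1]; near=> n.
have n0 : (0 < n)%N by near: n; exact: nbhs_infty_gt.
have qsn : q n <= e * sC n by near: n; exact: littleo_le_pos q_ge0 sC_ge0 qs e e0.
have /andP[C1 _] := C_facts n0.
move=> b1 b2 u v /(bg_U_xx' (w_ge0 n) (q_gt0 n))[x [y [xB yB ->]]].
have := apart_bounds_small (q_gt0 n) C1 e0 xB qsn.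
have := apart_bounds_small (q_gt0 n) C1 e0 yB qsn.
case: xB yB => x0 _ _ _ [y0 _ _ _] ye xe.
by apply: norm_le0; [apply: le_mixture | apply: mixture_le] => //;
  exact: bridge_odds_side_ge0.
Unshelve. all: by end_near. Qed.

Lemma cvg_xx'_1 : sC =o_\oo q -> U_cvg m w q (pair_xx' i) 1.
Proof.
move=> qs; apply: (@U_cvg_le _ 4) => // e /andP[e0 e1]; near=> n.
have n0 : (0 < n)%N by near: n; exact: nbhs_infty_gt.
have qsn : sC n <= e * q n by near: n; exact: littleo_le_pos sC_ge0 q_ge0 qs e e0.
have /andP[C1 _] := C_facts n0.
have ee : 0 < e <= 1 by rewrite e0.
move=> b1 b2 u v /(bg_U_xx' (w_ge0 n) (q_gt0 n))[x [y [xB yB ->]]].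
have := apart_bounds_large (q_gt0 n) C1 ee xB qsn.
have := apart_bounds_large (q_gt0 n) C1 ee yB qsn.
case: xB yB => _ x1 _ _ [_ y1 _ _] ye xe.
apply: norm_le1; first by apply: mixture_le => //; exact: bridge_odds_side_ge0.
rewrite lerBlDr addrC -lerBlDr.
by apply: le_mixture; try exact: bridge_odds_side_ge0; lra.
Unshelve. all: by end_near. Qed.

Lemma odds_ge0 n : 0 <= odds n.
Proof. by apply: addr_ge0; apply: bridge_odds_ge0. Qed.

Lemma cvg_bb'_0_of_odds : (forall e : R, 0 < e <= 1 ->
    \forall n \near \oo, 1 <= 2 * e * odds n) ->
  U_cvg m w q (pair_bb' i) 0.
Proof.
move=> H; apply: (@U_cvg_le _ 2) => // e e01.
have := H e e01; apply: filterS => n od b1 b2 u v /(bg_U_bb' (w_ge0 n) (q_gt0 n)) ->.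
have r0 := odds_ge0 n; have /andP[e0 _] := e01.
rewrite -addrA -/(odds n); apply: norm_le0.
  by apply: divr_ge0; lra.
rewrite ler_pdivrMr; nra.
Qed.

Lemma cvg_bb'_1_of_odds : (forall e : R, 0 < e <= 1 ->
    \forall n \near \oo, odds n <= 4 * e) ->
  U_cvg m w q (pair_bb' i) 1.
Proof.
move=> H; apply: (@U_cvg_le _ 4) => // e e01.
have := H e e01; apply: filterS => n od b1 b2 u v /(bg_U_bb' (w_ge0 n) (q_gt0 n)) ->.
have r0 := odds_ge0 n; have /andP[e0 _] := e01.
rewrite -addrA -/(odds n); apply: norm_le1.
  by rewrite ler_pdivrMr; lra.
rewrite lerBlDr -lerBlDl ler_pdivlMr; nra.
Qed.

Lemma odds_large_bridge e : 0 < e <= 1 ->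
  q =o_\oo (fun n => w n / M n) \/ (q =o_\oo w /\ M =o_\oo w) ->
  \forall n \near \oo, 1 <= 2 * e * odds n.
Proof.
move=> /andP[e0 e1] [qw|[qw Mw]]; near=> n;
  (have n0 : (0 < n)%N by near: n; exact: nbhs_infty_gt);
  have Mn := m_facts n0; have /andP[M1 _] := Mn; have q0 := q_gt0 n.
  have qn : q n <= e * (w n / M n).
    by near: n; exact: littleo_le_pos q_ge0 wM_ge0 qw e e0.
  have h := odds_ge_small (w_ge0 n) q0 Mn.
  suff : 1 <= e * (w n / (q n * M n)) by rewrite -/(odds n) in h; nra.
  have -> : e * (w n / (q n * M n)) = e * (w n / M n) / q n by field; lra.
  by rewrite ler_pdivlMr // mul1r.
have qn : q n <= e * w n by near: n; exact: littleo_le_pos q_ge0 w_ge0 qw e e0.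
have mn : M n <= e * w n by near: n; exact: littleo_le_pos M_ge0 w_ge0 Mw e e0.
have h := odds_ge_large (w_ge0 n) q0 Mn.
suff : 1 <= 2 * e * (w n / (q n + M n)) by rewrite -/(odds n) in h; nra.
by rewrite mulrA ler_pdivlMr; lra.
Unshelve. all: by end_near. Qed.

Lemma odds_small_bridge e : 0 < e <= 1 ->
  w =o_\oo q \/ ((fun n => w n / M n) =o_\oo q /\ w =o_\oo M) ->
  \forall n \near \oo, odds n <= 4 * e.
Proof.
move=> /andP[e0 e1] [wq|[wq wM]]; near=> n;
  (have n0 : (0 < n)%N by near: n; exact: nbhs_infty_gt);
  have Mn := m_facts n0; have /andP[M1 _] := Mn; have q0 := q_gt0 n.
  have qn : w n <= e * q n by near: n; exact: littleo_le_pos w_ge0 q_ge0 wq e e0.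
  have h := odds_le_large (w_ge0 n) q0 Mn; apply: le_trans h _.
  suff : w n / q n <= e by lra.
  by rewrite ler_pdivrMr.
have qn : w n / M n <= e * q n.
  by near: n; exact: littleo_le_pos wM_ge0 q_ge0 wq e e0.
have mn : w n <= e * M n by near: n; exact: littleo_le_pos w_ge0 M_ge0 wM e e0.
have h := odds_le_small (w_ge0 n) q0 Mn; apply: le_trans h _.
have h1 : w n / M n / q n <= e by rewrite ler_pdivrMr.
have h2 : w n / M n <= e by rewrite ler_pdivrMr; lra.
lra.
Unshelve. all: by end_near. Qed.

Lemma cvg_bx_0_slow : q =o_\oo (fun=> 1 : R) -> U_cvg m w q (pair_bx i) 0.
Proof.
move=> q1; apply: (@U_cvg_le _ 4) => // e /andP[e0 e1]; near=> n.
have n0 : (0 < n)%N by near: n; exact: nbhs_infty_gt.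
have qn : q n <= e * 1.
  by near: n; exact: littleo_le_pos q_ge0 (fun=> ler01) q1 e e0.
have /andP[C1 _] := C_facts n0; have q0 := q_gt0 n.
have sC1 : 1 <= sC n by rewrite -sqrtr1 ler_wsqrtr.
have qsn : q n <= e * sC n by nra.
move=> b1 b2 u v /(bg_U_bx (w_ge0 n) (q_gt0 n))[x xB ->].
have := apart_bounds_small q0 C1 e0 xB qsn.
case: xB => x0 _ _ _ xe.
have f0 : 0 <= q n / (q n + 1) by apply: divr_ge0; lra.
have f1 : q n / (q n + 1) <= 4 * e by rewrite ler_pdivrMr; nra.
by apply: norm_le0; [apply: le_mixture | apply: mixture_le] => //;
  exact: bridge_odds_side_ge0.
Unshelve. all: by end_near. Qed.

(** Unlike [mixture_le], this profits from a small weight [a] of the second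
    law. *)
Lemma mixture_le_split (a b x y c d : R) : 0 <= a -> 0 <= b -> 0 <= x -> 0 <= y ->
  x <= c -> a * y <= d * (1 + a + b) -> mixture a b x y <= c + d.
Proof.
move=> a0 b0 x0 y0 xc ayd; rewrite /mixture ler_pdivrMr; last by lra.
have : (1 + b) * x <= (1 + b) * c by apply: ler_wpM2l; lra.
have : 0 <= a * c by apply: mulr_ge0; lra.
lra.
Qed.

Lemma bridge_odds_half n D : 0 <= D ->
  bridge_odds (w n) (q n) D * (q n / (q n + 1)) = w n / (q n + D).
Proof.
move=> D0; have q0 := q_gt0 n; rewrite /bridge_odds; field; apply/andP; split; lra.
Qed.

(** The bridge is left from this side with a separation weight of
    [r q / (q + 1) = w / (q + |C_i|)], where [r] is the odds; it is small since
    [w] is small compared to the size of both cliques. *)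
Lemma cvg_bx_0_weak : q =o_\oo sC -> w =o_\oo M -> U_cvg m w q (pair_bx i) 0.
Proof.
move=> qs wM; apply: (@U_cvg_le _ 5) => // e /andP[e0 e1]; near=> n.
have n0 : (0 < n)%N by near: n; exact: nbhs_infty_gt.
have qsn : q n <= e * sC n by near: n; exact: littleo_le_pos q_ge0 sC_ge0 qs e e0.
have wn : w n <= e * M n by near: n; exact: littleo_le_pos w_ge0 M_ge0 wM e e0.
have /andP[C1 _] := C_facts n0; have q0 := q_gt0 n.
have MC : M n <= C n.
  by have /andP[_ +] := m_facts n0; rewrite /C /side /M /N; case: i.
move=> b1 b2 u v /(bg_U_bx (w_ge0 n) (q_gt0 n))[x xB ->].
have := apart_bounds_small q0 C1 e0 xB qsn.
case: xB => x0 _ _ _ xe.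
have f0 : 0 <= q n / (q n + 1) by apply: divr_ge0; lra.
have a0 := bridge_odds_side_ge0 n i; have b0 := bridge_odds_side_ge0 n (~~ i).
apply: norm_le0; first exact: le_mixture.
have -> : 5 * e = 4 * e + e by ring.
apply: mixture_le_split => //.
rewrite -/(C n) bridge_odds_half; last by lra.
apply: (@le_trans _ _ e); last by rewrite -/(C n) in a0; nra.
by rewrite ler_pdivrMr; nra.
Unshelve. all: by end_near. Qed.

Lemma side_n n : #|bg_clique n (m n) i| = n ->
  C n = N n /\ side R n (m n) (~~ i) = M n.
Proof.
rewrite card_bg_clique /C /side /N /M; case: i => //= e.
by rewrite e.
Qed.

Lemma side_m n : #|bg_clique n (m n) i| = m n ->
  C n = M n /\ side R n (m n) (~~ i) = N n.
Proof.
rewrite card_bg_clique /C /side /N /M; case: i => //= e.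
by rewrite -e.
Qed.

(** The bridge may well be used, but then mostly from the small clique to the
    large one: the odds of the two directions have ratio [(q + m) / (q + n)]. *)
Lemma cvg_bx_0_unbalanced : q =o_\oo sC -> M =o_\oo N ->
  (\forall n \near \oo, #|bg_clique n (m n) i| = n) ->
  U_cvg m w q (pair_bx i) 0.
Proof.
move=> qs MN Cn; apply: (@U_cvg_le _ 6) => // e /andP[e0 e1]; near=> n.
have n0 : (0 < n)%N by near: n; exact: nbhs_infty_gt.
have qsn : q n <= e * sC n by near: n; exact: littleo_le_pos q_ge0 sC_ge0 qs e e0.
have mn : M n <= e * N n by near: n; exact: littleo_le_pos M_ge0 N_ge0 MN e e0.
have /andP[C1 _] := C_facts n0; have q0 := q_gt0 n.
have /andP[M1 _] := m_facts n0.
have [CE sE] : C n = N n /\ side R n (m n) (~~ i) = M n.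
  by apply: side_n; near: n.
move=> b1 b2 u v /(bg_U_bx (w_ge0 n) (q_gt0 n))[x xB ->].
have := apart_bounds_small q0 C1 e0 xB qsn.
case: xB => x0 _ _ _ xe.
have f0 : 0 <= q n / (q n + 1) by apply: divr_ge0; lra.
have f1 : q n / (q n + 1) <= 1 by rewrite ler_pdivrMr; lra.
have a0 := bridge_odds_side_ge0 n i; have b0 := bridge_odds_side_ge0 n (~~ i).
apply: norm_le0; first exact: le_mixture.
have -> : 6 * e = 4 * e + 2 * e by ring.
apply: mixture_le_split => //.
rewrite -/(C n) in a0 *; rewrite sE in b0 *; rewrite CE in a0 C1 *.
have sN := sqrt_le_self C1.
have qN : q n <= e * N n by apply: le_trans qsn _; rewrite /sC CE ler_pM2l.
(* Cross-multiplied ratio of the odds, which stays valid for [w n = 0]. *)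
have ab : bridge_odds (w n) (q n) (N n) * (q n + N n) =
    bridge_odds (w n) (q n) (M n) * (q n + M n).
  by rewrite /bridge_odds; field; rewrite !gt_eqF //; lra.
set a := bridge_odds _ _ (N n) in a0 ab *.
set b := bridge_odds _ _ (M n) in b0 ab *.
have le_a : a * (q n / (q n + 1)) <= a by rewrite ler_piMr.
suff : a <= 2 * e * b by nra.
have h1 : a * N n <= a * (q n + N n) by apply: ler_wpM2l; lra.
have h2 : b * (q n + M n) <= b * (2 * e * N n) by apply: ler_wpM2l; lra.
rewrite -(ler_pM2r (_ : 0 < N n)); lra.
Unshelve. all: by end_near. Qed.

Lemma cvg_bx_1 : sC =o_\oo q -> U_cvg m w q (pair_bx i) 1.
Proof.
move=> qs; apply: (@U_cvg_le _ 4) => // e /andP[e0 e1]; near=> n.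
have n0 : (0 < n)%N by near: n; exact: nbhs_infty_gt.
have qsn : sC n <= e * q n by near: n; exact: littleo_le_pos sC_ge0 q_ge0 qs e e0.
have /andP[C1 _] := C_facts n0; have q0 := q_gt0 n.
have sC1 : 1 <= sC n by rewrite -sqrtr1 ler_wsqrtr.
have ee : 0 < e <= 1 by rewrite e0.
move=> b1 b2 u v /(bg_U_bx (w_ge0 n) (q_gt0 n))[x xB ->].
have := apart_bounds_large (q_gt0 n) C1 ee xB qsn.
case: xB => _ x1 _ _ xe.
have f1 : q n / (q n + 1) <= 1 by rewrite ler_pdivrMr; lra.
have f0 : 1 - 4 * e <= q n / (q n + 1) by rewrite ler_pdivlMr; nra.
apply: norm_le1; first by apply: mixture_le => //; exact: bridge_odds_side_ge0.
rewrite lerBlDr addrC -lerBlDr.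
by apply: le_mixture; try exact: bridge_odds_side_ge0; lra.
Unshelve. all: by end_near. Qed.

Lemma cvg_xy_0 : q =o_\oo (fun=> 1 : R) -> q =o_\oo (fun n => w n / M n) ->
  U_cvg m w q (pair_xy i) 0.
Proof.
move=> q1 qw; apply: (@U_cvg_le _ 7) => // e /andP[e0 e1]; near=> n.
have n0 : (0 < n)%N by near: n; exact: nbhs_infty_gt.
have qn : q n <= e * 1.
  by near: n; exact: littleo_le_pos q_ge0 (fun=> ler01) q1 e e0.
have q0 := q_gt0 n; have r0 := odds_ge0 n.
have r1 : 1 <= 2 * e * odds n.
  by near: n; apply: odds_large_bridge; [rewrite e0 | left].
have Mn := m_facts n0; have /andP[M1 MN] := Mn.
have N1 : 1 <= N n by lra.
move=> b1 b2 u v /(bg_U_xy (w_ge0 n) (q_gt0 n))[x [x' [xB xB']]].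
have qs (D : R) : 1 <= D -> q n <= e * Num.sqrt D.
  by move=> D1; apply: le_trans qn _; rewrite ler_pM2l // -sqrtr1 ler_wsqrtr.
have := apart_bounds_small q0 N1 e0 xB (qs _ N1).
have := apart_bounds_small q0 M1 e0 xB' (qs _ M1).
case: xB xB' => x0 x1 _ _ [x0' x1' _ _] xe' xe.
rewrite -addrA -/(odds n).
have a0 : 0 <= bridge_odds (w n) (q n) n%:R by apply: bridge_odds_ge0.
have b0 : 0 <= bridge_odds (w n) (q n) (m n)%:R by apply: bridge_odds_ge0.
set a := bridge_odds _ _ n%:R in a0 *; set b := bridge_odds _ _ (m n)%:R in b0 *.
have rE : odds n = a + b by [].
set U := bg_U _ _ _ _ _ _ => UE.
have d0 : 0 < (1 + odds n) * (q n + 1) by apply: mulr_gt0; lra.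
have n1 : a * (1 - x') + b * (1 - x) <= odds n.
  have : 0 <= a * x' by apply: mulr_ge0.
  have : 0 <= b * x by apply: mulr_ge0.
  by rewrite rE; lra.
have n2 : odds n * (1 - 4 * e) <= a * (1 - x') + b * (1 - x).
  have : a * x' <= a * (4 * e) by apply: ler_wpM2l.
  have : b * x <= b * (4 * e) by apply: ler_wpM2l.
  by rewrite rE; lra.
apply: norm_le0.
  suff : 1 - U <= 1 by lra.
  rewrite UE ler_pdivrMr // mul1r.
  have : 0 <= (1 + odds n) * q n by apply: mulr_ge0; lra.
  lra.
suff : 1 - 7 * e <= 1 - U by lra.
rewrite UE ler_pdivlMr //.
have [e7|e7] := leP (1 - 7 * e) 0.
  apply: (@le_trans _ _ 0); first by apply: mulr_le0_ge0 => //; lra.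
  by apply: addr_ge0; apply: mulr_ge0 => //; lra.
(* [1 <= 2 * e * odds n] and [q n <= e] bound the denominator by
   [(1 + 2 * e) * (1 + e)] times the odds. *)
apply: le_trans n2.
have h1 : (1 + odds n) * (q n + 1) <= (1 + 2 * e) * odds n * (1 + e).
  by apply: ler_pM; lra.
have h2 : (1 - 7 * e) * ((1 + odds n) * (q n + 1)) <=
    (1 - 7 * e) * ((1 + 2 * e) * odds n * (1 + e)).
  by apply: ler_wpM2l; lra.
apply: le_trans h2 _.
have -> : (1 - 7 * e) * ((1 + 2 * e) * odds n * (1 + e)) =
  odds n * (1 - 4 * e) - odds n * (19 * e ^+ 2 + 14 * e ^+ 3) by ring.
rewrite gerBl; apply: mulr_ge0 => //.
by apply: addr_ge0; apply: mulr_ge0; rewrite ?exprn_ge0 //; lra.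
Unshelve. all: by end_near. Qed.

Lemma cvg_xy_1 : (fun=> 1 : R) =o_\oo q \/
    (q =o_\oo (fun=> 1 : R) /\ (fun n => w n / M n) =o_\oo q) ->
  U_cvg m w q (pair_xy i) 1.
Proof.
move=> hyp; apply: (@U_cvg_le _ 4) => // e /andP[e0 e1].
have : \forall n \near \oo, 1 / (q n + 1) <= 4 * e \/ odds n <= 4 * e.
  case: hyp => [q1|[q1 qw]]; near=> n; have q0 := q_gt0 n.
    have qn : 1 <= e * q n.
      by near: n; exact: littleo_le_pos (fun=> ler01) q_ge0 q1 e e0.
    by left; rewrite ler_pdivrMr; nra.
  have n0 : (0 < n)%N by near: n; exact: nbhs_infty_gt.
  have Mn := m_facts n0; have /andP[M1 _] := Mn.
  have qn : q n <= 1 * 1.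
    by near: n; exact: littleo_le_pos q_ge0 (fun=> ler01) q1 1 ltr01.
  have wn : w n / M n <= e * q n.
    by near: n; exact: littleo_le_pos wM_ge0 q_ge0 qw e e0.
  right; apply: le_trans (odds_le_small (w_ge0 n) q0 Mn) _.
  have : w n / M n / q n <= e by rewrite ler_pdivrMr.
  have : e * q n <= e * 1 by rewrite ler_pM2l //; lra.
  lra.
clear hyp; apply: filterS => n small b1 b2 u v.
move=> /(bg_U_xy (w_ge0 n) (q_gt0 n))[x [x' [xB xB' UE]]].
have q0 := q_gt0 n; have r0 := odds_ge0 n; move: UE.
case: xB xB' => x0 x1 _ _ [x0' x1' _ _].
rewrite -addrA -/(odds n).
have a0 : 0 <= bridge_odds (w n) (q n) n%:R by apply: bridge_odds_ge0.
have b0 : 0 <= bridge_odds (w n) (q n) (m n)%:R by apply: bridge_odds_ge0.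
set a := bridge_odds _ _ n%:R in a0 *; set b := bridge_odds _ _ (m n)%:R in b0 *.
have rE : odds n = a + b by [].
set U := bg_U _ _ _ _ _ _ => UE.
have d0 : 0 < (1 + odds n) * (q n + 1) by apply: mulr_gt0; lra.
have p0 : 0 <= a * (1 - x') + b * (1 - x).
  by apply: addr_ge0; apply: mulr_ge0 => //; lra.
have n1 : a * (1 - x') + b * (1 - x) <= odds n.
  have : 0 <= a * x' by apply: mulr_ge0.
  have : 0 <= b * x by apply: mulr_ge0.
  by rewrite rE; lra.
apply: norm_le1.
  suff : 0 <= 1 - U by lra.
  by rewrite UE; apply: divr_ge0 => //; lra.
have rq : 0 <= odds n * q n by apply: mulr_ge0; lra.
rewrite UE; case: small => small; apply: le_trans small.
  rewrite ler_pdivrMr //.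
  have -> : 1 / (q n + 1) * ((1 + odds n) * (q n + 1)) = 1 + odds n.
    by field; lra.
  by lra.
rewrite ler_pdivrMr //; apply: le_trans n1 _; rewrite ler_peMr //.
nra.
Unshelve. all: by end_near. Qed.

(** The bridge is used with high probability, and [b] and [x] are separated
    exactly if it is left from their side; the probability of that direction is
    the ratio whose limit is assumed to be [l]. *)
Lemma cvg_bx_limit (c l : R) : 0 < c <= 1 -> (fun=> 1 : R) =o_\oo q ->
  q =o_\oo sC -> M =o_\oo w -> (fun n => M n / (c * N n)) @ \oo --> (1 : R) ->
  (forall e, 0 < e <= 1 -> \forall n \near \oo,
     q n <= e * N n -> `|M n - c * N n| <= e * (c * N n) ->
     `|(q n + side R n (m n) (~~ i)) / (2 * q n + N n + M n) - l| <= 2 * e) ->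
  U_cvg m w q (pair_bx i) l.
Proof.
move=> /andP[c0 c1] q1 qs Mw mc limE; apply: (@U_cvg_le _ 8) => // e e01.
have /andP[e0 e1] := e01.
(* Below, [M n >= c * N n / 2] and [q n <= N n], so that [q n + M n] is at most
   [3 / c * M n]; the factor [e * c / 3] then makes it at most [e * w n]. *)
have ec0 : 0 < e * c / 3 by rewrite divr_gt0 // mulr_gt0.
have half0 : 0 < 1 / 2 :> R by rewrite divr_gt0.
near=> n.
have n0 : (0 < n)%N by near: n; exact: nbhs_infty_gt.
have qn : 1 <= e * q n.
  by near: n; exact: littleo_le_pos (fun=> ler01) q_ge0 q1 e e0.
have qsn : q n <= e * sC n by near: n; exact: littleo_le_pos q_ge0 sC_ge0 qs e e0.
have mw : M n <= e * c / 3 * w n.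
  by near: n; exact: littleo_le_pos M_ge0 w_ge0 Mw _ ec0.
have Mn := m_facts n0; have /andP[M1 MN] := Mn.
have /andP[C1 CN] := C_facts n0; have q0 := q_gt0 n.
have cN0 : 0 < c * N n by apply: mulr_gt0; lra.
have dist (d : R) : `|1 - M n / (c * N n)| <= d ->
    `|M n - c * N n| <= d * (c * N n).
  have -> : M n - c * N n = - ((1 - M n / (c * N n)) * (c * N n)).
    by field; rewrite !gt_eqF //; lra.
  by rewrite normrN normrM (ger0_norm (ltW cN0)) ler_pM2r.
have mc1 : `|M n - c * N n| <= e * (c * N n).
  by apply: dist; near: n; move/cvgrPdist_le : mc; exact.
have mc2 : `|M n - c * N n| <= 1 / 2 * (c * N n).
  by apply: dist; near: n; move/cvgrPdist_le : mc; exact.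
have sCC := sqrt_le_self C1.
have qN : q n <= e * N n.
  by apply: le_trans qsn _; rewrite /sC ler_pM2l //; lra.
have kl : `|(q n + side R n (m n) (~~ i)) / (2 * q n + N n + M n) - l| <= 2 * e.
  by move: qN mc1; near: n; exact: limE.
have qM : (q n + M n) <= 3 / c * M n.
  have -> : 3 / c * M n = M n / c + 2 * M n / c by field; lra.
  have h1 : M n <= M n / c by rewrite ler_pdivlMr // ler_piMr; lra.
  have h2 : N n <= 2 * M n / c.
    rewrite ler_pdivlMr //; move: mc2; rewrite ler_norml => /andP[]; lra.
  have : e * N n <= 1 * N n by apply: ler_wpM2r; lra.
  lra.
have r1 : 1 <= e * odds n.
  have h := odds_ge_large (w_ge0 n) q0 Mn.
  suff : 1 <= e * (w n / (q n + M n)).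
    by move=> /le_trans; apply; rewrite ler_pM2l.
  rewrite mulrA ler_pdivlMr ?mul1r; last by lra.
  apply: le_trans qM _.
  have : 3 / c * M n <= 3 / c * (e * c / 3 * w n).
    by rewrite ler_pM2l // divr_gt0.
  by have -> : 3 / c * (e * c / 3 * w n) = e * w n by field; lra.
move=> b1 b2 u v /(bg_U_bx (w_ge0 n) (q_gt0 n))[x xB ->].
have := apart_bounds_small q0 C1 e0 xB qsn.
case: xB => x0 x1 _ _ xe.
have a0 := bridge_odds_side_ge0 n i; have b0 := bridge_odds_side_ge0 n (~~ i).
have abr := oddsE n; have := sides n; rewrite -/(C n) in a0 abr *.
set D := side _ _ _ _ in b0 abr kl * => CD.
have D0 : 0 <= D by rewrite ler0n.
have kE : bridge_odds (w n) (q n) (C n) =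
    (q n + D) / (2 * q n + N n + M n) * odds n.
  have -> : 2 * q n + N n + M n = 2 * q n + (C n + D) by rewrite CD; ring.
  rewrite -abr.
  rewrite /bridge_odds; field; rewrite !gt_eqF //; lra.
set a := bridge_odds _ _ (C n) in a0 abr kE *.
set b := bridge_odds _ _ D in b0 abr *.
set share := (q n + D) / _ in kl kE.
have share0 : 0 <= share by apply: divr_ge0; lra.
have b1' : 1 - e <= q n / (q n + 1) by rewrite ler_pdivlMr; nra.
have b2' : q n / (q n + 1) <= 1 by rewrite ler_pdivrMr; lra.
have share1 : share <= 1 by rewrite ler_pdivrMr; have := sides n; lra.
have r0 := odds_ge0 n.
have up : mixture a b x (q n / (q n + 1)) <= 4 * e + share.
  apply: mixture_le_split => //; first by apply: divr_ge0; lra.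
  rewrite -addrA abr mulrDr mulr1 -kE.
  have : a * (q n / (q n + 1)) <= a by rewrite ler_piMr.
  lra.
have lo : share - 2 * e <= mixture a b x (q n / (q n + 1)).
  rewrite /mixture ler_pdivlMr; last by lra.
  rewrite -addrA abr.
  have h1 : a * (1 - e) <= a * (q n / (q n + 1)) by apply: ler_wpM2l.
  have h2 : 0 <= (1 + b) * x by apply: mulr_ge0; lra.
  have h3 : share * odds n <= odds n by rewrite ler_piMl.
  have h4 : e * a <= e * odds n by rewrite ler_pM2l // kE.
  rewrite -kE in h3.
  have -> : (share - 2 * e) * (1 + odds n) =
      share + share * odds n - 2 * e - 2 * (e * odds n) by ring.
  by rewrite -kE; lra.
move: kl; rewrite !ler_norml => /andP[kl1 kl2].
apply/andP; split; lra.
Unshelve. all: by end_near. Qed.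

Lemma cvg_bx_n c : 0 < c <= 1 -> (fun=> 1 : R) =o_\oo q ->
  q =o_\oo sC -> M =o_\oo w ->
  (\forall n \near \oo, #|bg_clique n (m n) i| = n) ->
  (fun n => M n / (c * N n)) @ \oo --> (1 : R) ->
  U_cvg m w q (pair_bx i) (c / (1 + c)).
Proof.
move=> c01 q1 qs Mw Cn mc; apply: (@cvg_bx_limit c) => // e /andP[e0 e1].
have /andP[c0 c1] := c01.
near=> n => qN; rewrite ler_norml => /andP[m1 m2].
have n0 : (0 < n)%N by near: n; exact: nbhs_infty_gt.
have /andP[M1 MN] := m_facts n0; have q0 := q_gt0 n.
have [_ ->] : C n = N n /\ side R n (m n) (~~ i) = M n.
  by apply: side_n; near: n.
have d0 : 0 < (1 + c) * (2 * q n + N n + M n) by apply: mulr_gt0; lra.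
have -> : (q n + M n) / (2 * q n + N n + M n) - c / (1 + c) =
  ((1 - c) * q n + (M n - c * N n)) / ((1 + c) * (2 * q n + N n + M n)).
  by field; rewrite !gt_eqF //; lra.
have h1 : N n <= (1 + c) * (2 * q n + N n + M n) by nra.
have h2 : e * N n <= e * ((1 + c) * (2 * q n + N n + M n)) by rewrite ler_pM2l.
have h3 : (1 - c) * q n <= q n by rewrite ler_piMl //; lra.
have h3' : 0 <= (1 - c) * q n by apply: mulr_ge0; lra.
have h4 : e * (c * N n) <= e * N n by rewrite ler_pM2l // ler_piMl; lra.
by rewrite ler_norml ler_pdivlMr // ler_pdivrMr //; apply/andP; split; lra.
Unshelve. all: by end_near. Qed.

Lemma cvg_bx_m c : 0 < c <= 1 -> (fun=> 1 : R) =o_\oo q ->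
  q =o_\oo sC -> M =o_\oo w ->
  (\forall n \near \oo, #|bg_clique n (m n) i| = m n) ->
  (fun n => M n / (c * N n)) @ \oo --> (1 : R) ->
  U_cvg m w q (pair_bx i) (1 / (1 + c)).
Proof.
move=> c01 q1 qs Mw Cn mc; apply: (@cvg_bx_limit c) => // e /andP[e0 e1].
have /andP[c0 c1] := c01.
near=> n => qN; rewrite ler_norml => /andP[m1 m2].
have n0 : (0 < n)%N by near: n; exact: nbhs_infty_gt.
have /andP[M1 MN] := m_facts n0; have q0 := q_gt0 n.
have [_ ->] : C n = M n /\ side R n (m n) (~~ i) = N n.
  by apply: side_m; near: n.
have d0 : 0 < (1 + c) * (2 * q n + N n + M n) by apply: mulr_gt0; lra.
have -> : (q n + N n) / (2 * q n + N n + M n) - 1 / (1 + c) =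
  - ((1 - c) * q n + (M n - c * N n)) / ((1 + c) * (2 * q n + N n + M n)).
  by field; rewrite !gt_eqF //; lra.
have h1 : N n <= (1 + c) * (2 * q n + N n + M n) by nra.
have h2 : e * N n <= e * ((1 + c) * (2 * q n + N n + M n)) by rewrite ler_pM2l.
have h3 : (1 - c) * q n <= q n by rewrite ler_piMl //; lra.
have h3' : 0 <= (1 - c) * q n by apply: mulr_ge0; lra.
have h4 : e * (c * N n) <= e * N n by rewrite ler_pM2l // ler_piMl; lra.
by rewrite ler_norml ler_pdivlMr // ler_pdivrMr //; apply/andP; split; lra.
Unshelve. all: by end_near. Qed.

End Limits.

Theorem theorem8 (R : realType) :
  (forall (n m : nat) (b1 : 'I_n) (b2 : 'I_m) (w q : R),
     (1 < n)%N \/ q + n%:R != 0 ->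
     (1 < m)%N \/ q + m%:R != 0 ->
     bg_Z b1 b2 w q =
       q * (q * (q + n%:R) * (q + m%:R)
            + w * (q + 1) * (2 * q + n%:R + m%:R))
         * (q + n%:R) ^ (n%:Z - 2) * (q + m%:R) ^ (m%:Z - 2))
  /\
  (forall (m : nat -> nat) (w q : nat -> R) (i : bool),
     (forall n, (0 < n)%N -> (0 < m n <= n)%N) ->
     (forall n, 0 <= w n) ->
     (forall n, 0 < q n) ->
     let N  : nat -> R := fun n => n%:R in
     let M  : nat -> R := fun n => (m n)%:R in
     let one : nat -> R := fun=> 1 in
     let wM : nat -> R := fun n => w n / (m n)%:R in
     let sC : nat -> R :=
       fun n => Num.sqrt (#|bg_clique n (m n) i|%:R) in
     let Ci_is_n := \forall n \near \oo, #|bg_clique n (m n) i| = n in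
     let Ci_is_m := \forall n \near \oo, #|bg_clique n (m n) i| = m n in
     let m_sim (c : R) :=
       (fun n => M n / (c * N n)) @ \oo --> (1 : R) in
     [/\ (* U_q(x, x') *)
         (q =o_\oo sC -> U_cvg m w q (pair_xx' i) 0)
         /\ (omega q sC -> U_cvg m w q (pair_xx' i) 1),
         (* U_q(b, b') *)
         (q =o_\oo wM \/ (q =o_\oo w /\ omega w M) ->
            U_cvg m w q (pair_bb' i) 0)
         /\ (omega q w \/ (omega q wM /\ w =o_\oo M) ->
            U_cvg m w q (pair_bb' i) 1),
         (* U_q(b, x) *)
         [/\ [\/ q =o_\oo one,
                 q =o_\oo sC /\ w =o_\oo M |
                 [/\ q =o_\oo sC, M =o_\oo N & Ci_is_n]] ->
               U_cvg m w q (pair_bx i) 0,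
             forall c : R, 0 < c <= 1 ->
               omega q one -> q =o_\oo sC -> omega w M ->
               Ci_is_n -> m_sim c ->
               U_cvg m w q (pair_bx i) (c / (1 + c)),
             forall c : R, 0 < c <= 1 ->
               omega q one -> q =o_\oo sC -> omega w M ->
               Ci_is_m -> m_sim c ->
               U_cvg m w q (pair_bx i) (1 / (1 + c)) &
             omega q sC -> U_cvg m w q (pair_bx i) 1]
       & (* U_q(x, y) *)
         (q =o_\oo one /\ q =o_\oo wM -> U_cvg m w q (pair_xy i) 0)
         /\ (omega q one \/ (q =o_\oo one /\ omega q wM) ->
            U_cvg m w q (pair_xy i) 1)]).
Proof.
split=> [n m b1 b2 w q|m w q i m_le w_ge0 q_gt0]; first exact: bg_ZE.
move=> N M one wM sC Ci_is_n Ci_is_m m_sim.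
have sCE : sC = fun n => Num.sqrt (side R n (m n) i).
  by apply/funext => n; rewrite /sC card_bg_clique.
rewrite {}sCE {sC}; split; [split|split|split|split].
- exact: cvg_xx'_0.
- exact: cvg_xx'_1.
- by move=> h; apply: cvg_bb'_0_of_odds => // e e01; exact: odds_large_bridge.
- by move=> h; apply: cvg_bb'_1_of_odds => // e e01; exact: odds_small_bridge.
- by case=> [|[]|[]]; [exact: cvg_bx_0_slow|exact: cvg_bx_0_weak|
    exact: cvg_bx_0_unbalanced].
- by move=> c c01 q1 qs Mw Cn mc; exact: cvg_bx_n.
- by move=> c c01 q1 qs Mw Cn mc; exact: cvg_bx_m.
- exact: cvg_bx_1.
- by case; exact: cvg_xy_0.
- exact: cvg_xy_1.
Qed.
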